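(* Fix integers $m\ge 1$, $K\ge 1$ and reals $d,v,b>0$ and $0<w_0<w_c$. There exists a constant $\mu>0$, depending only on $v,d,K,b,w_0,w_c$ and $m$, such that for all payoffs $\mathbf T>\mathbf R>0$ and $\mathbf S>\mathbf P>0$ with $$\mu\,\mathbf R<\mathbf S ,$$ and for every initial configuration $\sigma$ containing at least one defector with positive wealth, the Demographic Prisoner's Dilemma process started from $\sigma$ satisfies $$\mathbb P_\sigma\big(\text{eventually all the cooperators are dead}\big)=1,$$ i.e. $\mathbb P_\sigma$-almost surely there is $t_0<\infty$ such that for all $t\ge t_0$ and all $i\in\{1,\dots,K\}$ with $Z^i(t)=0$ one has $Y^i(t)\le 0$.
   Context: Demographic Prisoner's Dilemma (spatial model). A configuration is an element $\sigma=(X^i,Y^i,Z^i)_{1\le i\le K}$ of $E=\big((\mathbb Z/m\mathbb Z)^2\times\mathbb R\times\{-1,0,1\}\big)^K$. Here $X^i$ is the position, $Y^i$ the wealth and $Z^i$ the strategy of particle $i$: $Z^i=0$ means $i$ is a cooperator, $Z^i=1$ means $i$ is a defector, $Z^i=-1$ means $i$ is not yet born and does not play. A particle with non-positive wealth is dead: it no longer plays. The continuous-time Markov chain $(X(t),Y(t),Z(t))_{t\ge0}$ on $E$, with law $\mathbb P_\sigma$ when started from $\sigma$, evolves as follows, all Poisson processes and random choices being independent. (Moves) Each particle $i$ performs a continuous-time simple symmetric random walk of rate $d$ on $(\mathbb Z/m\mathbb Z)^2$: at rate $d$ it jumps to one of its four neighbours, chosen uniformly. (Games) Each unordered pair $\{i,j\}$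 of distinct particles has a Poisson process of rate $v$. When it rings, if $X^i=X^j$, $Y^i>0$, $Y^j>0$ and $Z^i,Z^j\neq-1$, the two particles play and the payoffs are added to their wealths; otherwise nothing happens. Payoffs: two cooperators each receive $\mathbf R$; if a cooperator meets a defector, the cooperator receives $-\mathbf S$ and the defector $\mathbf T$; if two defectors meet, the pair of payoffs is $(-2\mathbf P,0)$ or $(0,-2\mathbf P)$ with probability $1/2$ each. (Births) Each particle $i$ has a Poisson process of rate $b$. When it rings, if $Z^i\ne-1$, $Y^i>w_c$ and there is some index $j$ with $Z^j=-1$, then such a $j$ is chosen uniformly at random and one sets $X^j\leftarrow X^i$, $Y^j\leftarrow w_0$, $Z^j\leftarrow Z^i$, $Y^i\leftarrow Y^i-w_0$; otherwise nothing happens. *)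

(* Defs.v *)
From HB Require Import structures.
From mathcomp Require Import all_boot all_order all_algebra.
From mathcomp Require Import all_classical all_reals all_analysis.

Set Implicit Arguments.
Unset Strict Implicit.
Unset Printing Implicit Defensive.

Import Order.TTheory GRing.Theory Num.Theory.
Import numFieldNormedType.Exports.

Local Open Scope classical_set_scope.
Local Open Scope ring_scope.

(** * Independence and Poisson processes *)

Section Probability.
Context (disp : measure_display) (Om : measurableType disp) (R : realType).
Variable P : probability Om R.

(* Mutual independence of a family of classes of events: the product rule on
   every finite subfamily [s 0, ..., s (n - 1)] of distinct indices. *)
Definition independent_classes (I : Type) (F : I -> set (set Om)) : Prop :=
  forall (n : nat) (s : 'I_n -> I) (A : 'I_n -> set Om),
    injective s -> (forall k, F (s k) (A k)) ->
    P (\bigcap_k A k) = (\prod_(k < n) P (A k))%E.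

(* Meant for countable [V], endowed with its discrete sigma-algebra. *)
Definition events_of (V : Type) (X : Om -> V) : set (set Om) :=
  [set X @^-1` B | B in [set: set V]].

Definition process_events (V : Type) (X : R -> Om -> V) : set (set Om) :=
  <<s \bigcup_(t in [set t : R | 0 <= t]) events_of (X t) >>.

(* [N t w] is the number of rings in the time interval ]0, t]; only the
   times [0 <= t] are relevant. *)
Record poisson_process (rate : R) (N : R -> Om -> nat) : Prop := {
  poisson_measurable : forall t : R, 0 <= t -> measurable_fun [set: Om] (N t);
  poisson_start : forall w, N 0 w = 0%N;
  poisson_nondecreasing : forall w (s t : R), 0 <= s -> s <= t ->
    (N s w <= N t w)%N;
  poisson_right_continuous : forall w (t : R), 0 <= t ->
    \forall s \near t^'+, N s w = N t w;
  poisson_increments : forall (s t : R) (k : nat), 0 <= s -> s < t ->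
    P [set w | (N t w - N s w)%N = k] = (poisson_pmf (rate * (t - s)) k)%:E;
  poisson_independent_increments : forall t : nat -> R,
    0 <= t 0%N -> (forall k, t k <= t k.+1) ->
    independent_classes
      (fun k : nat => events_of (fun w => N (t k.+1) w - N (t k) w)%N)
}.

(* For empty [A] only measurability is required. *)
Definition uniform_on (V : finType) (A : {set V}) (X : Om -> V) : Prop :=
  (forall v, measurable (X @^-1` [set v])) /\
  (forall v, v \in A -> P (X @^-1` [set v]) = ((#|A|%:R)^-1)%:E).

End Probability.

(** * Configurations *)

(* The values 0, 1 and -1 of the strategy coordinate, in this order. *)
Inductive strategy := Cooperator | Defector | Unborn.

Definition is_unborn (z : strategy) : bool :=
  if z is Unborn then true else false.

Section Model.
Variables (R : realType) (m K : nat).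

(* The torus is ['I_m * 'I_m] rather than a product of ['Z_m], because
   ['Z_1] has two elements. *)
Record particle := Particle {
  position : 'I_m * 'I_m;
  wealth : R;
  strat : strategy
}.

Definition config := 'I_K -> particle.

Record payoffs := Payoffs {
  temptation : R;
  reward : R;
  sucker : R;
  punishment : R
}.

(** * Update rules *)

(* A direction is a pair (axis, sense). For [m <= 2] some of the four
   neighbours coincide, and are counted with multiplicity. *)
Definition torus_step (e : bool * bool) (x : 'I_m * 'I_m) : 'I_m * 'I_m :=
  let shift k := if e.2 then ordS k else ord_pred k in
  if e.1 then (x.1, shift x.2) else (shift x.1, x.2).

Definition do_move (i : 'I_K) (e : bool * bool) (s : config) : config :=
  fun k => if k == i
    then Particle (torus_step e (position (s k))) (wealth (s k)) (strat (s k))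
    else s k.

Definition can_play (p : particle) : bool :=
  (0 < wealth p) && ~~ is_unborn (strat p).

(* [coin] only matters between two defectors: it tells who loses. The last
   case never occurs between particles that can play. *)
Definition game_payoff (g : payoffs) (coin : bool) (z z' : strategy) : R * R :=
  match z, z' with
  | Cooperator, Cooperator => (reward g, reward g)
  | Cooperator, Defector => (- sucker g, temptation g)
  | Defector, Cooperator => (temptation g, - sucker g)
  | Defector, Defector =>
      if coin then (- (2 * punishment g), 0) else (0, - (2 * punishment g))
  | _, _ => (0, 0)
  end.

Definition add_wealth (p : particle) (a : R) : particle :=
  Particle (position p) (wealth p + a) (strat p).

Definition do_game (g : payoffs) (i j : 'I_K) (coin : bool) (s : config) :
    config :=
  if [&& position (s i) == position (s j), can_play (s i) & can_play (s j)]
  then let q := game_payoff g coin (strat (s i)) (strat (s j)) in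
    fun k => if k == i then add_wealth (s i) q.1
             else if k == j then add_wealth (s j) q.2
             else s k
  else s.

Definition unborn (s : config) : {set 'I_K} :=
  [set j | is_unborn (strat (s j))]%SET.

(* [pick A] is the particle chosen when the set of unborn particles is [A]. *)
Definition do_birth (w0 wc : R) (i : 'I_K) (pick : {set 'I_K} -> 'I_K)
    (s : config) : config :=
  if [&& ~~ is_unborn (strat (s i)), wc < wealth (s i) & unborn s != finset.set0]
  then let j := pick (unborn s) in
    fun k => if k == j then Particle (position (s i)) w0 (strat (s i))
             else if k == i then add_wealth (s i) (- w0)
             else s k
  else s.

(** * Clocks and random choices *)

(* Unordered pairs of distinct particles. *)
Definition upair := {ij : 'I_K * 'I_K | (ij.1 < ij.2)%N}.

Inductive clock :=
  | MoveClock of 'I_K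
  | GameClock of upair
  | BirthClock of 'I_K.

Definition clock_rate (d v b : R) (c : clock) : R :=
  match c with
  | MoveClock _ => d
  | GameClock _ => v
  | BirthClock _ => b
  end.

Section Noise.
Context (disp : measure_display) (Om : measurableType disp).

(* The second argument of the last three fields numbers, from 0, the rings of
   the corresponding clock. [child i n A] is the choice made in [A] by
   particle [i] at that ring, should [A] be the set of unborn particles. *)
Record noise := Noise {
  ring_count : clock -> R -> Om -> nat;
  direction : 'I_K -> nat -> Om -> bool * bool;
  coin : upair -> nat -> Om -> bool;
  child : 'I_K -> nat -> {set 'I_K} -> Om -> 'I_K
}.

Inductive source :=
  | ClockSource of clock
  | DirectionSource of 'I_K & nat
  | CoinSource of upair & nat
  | ChildSource of 'I_K & nat & {set 'I_K}.

Definition source_events (X : noise) (a : source) : set (set Om) :=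
  match a with
  | ClockSource c => process_events (ring_count X c)
  | DirectionSource i n => events_of (direction X i n)
  | CoinSource p n => events_of (coin X p n)
  | ChildSource i n A => events_of (child X i n A)
  end.

Record dpd_noise (P : probability Om R) (d v b : R) (X : noise) : Prop := {
  noise_clocks : forall c,
    poisson_process P (clock_rate d v b c) (ring_count X c);
  noise_directions : forall i n,
    uniform_on P [set: bool * bool]%SET (direction X i n);
  noise_coins : forall p n, uniform_on P [set: bool]%SET (coin X p n);
  noise_children : forall i n A, uniform_on P A (child X i n A);
  noise_independent : independent_classes P (source_events X)
}.

(** * The process *)

(* Effect on the configuration of the ring number [n] of clock [c]. *)
Definition ring_effect (w0 wc : R) (g : payoffs) (X : noise) (w : Om)
    (c : clock) (n : nat) (s : config) : config :=
  match c with
  | MoveClock i => do_move i (direction X i n w) s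
  | GameClock p => do_game g (val p).1 (val p).2 (coin X p n w) s
  | BirthClock i => do_birth w0 wc i (fun A => child X i n A w) s
  end.

(* The trajectory [x] is constant on time intervals without ring, and changes
   by [ring_effect] over an interval ]s, t] containing exactly one ring.
   Almost surely no two clocks ring simultaneously and there are finitely many
   rings in bounded time, so that this determines [x t] for all [t >= 0]. *)
Record dpd_trajectory (w0 wc : R) (g : payoffs) (s0 : config) (X : noise)
    (w : Om) (x : R -> config) : Prop := {
  trajectory_start : x 0 = s0;
  trajectory_constant : forall s t : R, 0 <= s -> s <= t ->
    (forall c, ring_count X c t w = ring_count X c s w) -> x t = x s;
  trajectory_ring : forall (s t : R) c, 0 <= s -> s <= t ->
    ring_count X c t w = (ring_count X c s w).+1 ->
    (forall c', c' <> c -> ring_count X c' t w = ring_count X c' s w) ->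
    x t = ring_effect w0 wc g X w c (ring_count X c s w) (x s)
}.

(* [x] is a Demographic Prisoner's Dilemma process started from [s0]. *)
Definition dpd_process (P : probability Om R) (d v b w0 wc : R) (g : payoffs)
    (s0 : config) (x : R -> Om -> config) : Prop :=
  exists2 X : noise, dpd_noise P d v b X &
    {ae P, forall w, dpd_trajectory w0 wc g s0 X w (fun t => x t w)}.

End Noise.

End Model.

(* Main.v *)
(* While cooperator [i] is alive, its wealth grows by at most the reward times
   the number of games, and some defector is always alive: of two defectors who
   meet, only one loses. Consider the script in which [i] tours the torus and,
   at every site, the games of [i] with all the others ring, nothing else
   happening. Whatever the configuration at its beginning, if [i] survives the
   script then it meets a living defector and pays [sucker]: during the script
   that defector stays where it is and does not play against other defectors.
   Prescribing one ring per unit of time, the script is performed during a given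
   window with a probability depending on [m], [K] and the rates only, and
   independently for different windows. By Chebyshev's inequality the number of
   windows with a script is therefore linear in time, and so is, by a Chernoff
   bound, the number of games. If [sucker / reward] exceeds the ratio of the two
   slopes, then [i] cannot survive for ever. *)
From HB Require Import structures.
Require Import Defs.
From mathcomp Require Import all_boot all_order all_algebra.
From mathcomp Require Import all_classical all_reals all_analysis.
From mathcomp Require Import measurable_realfun ring lra.
Import Order.TTheory GRing.Theory Num.Theory.
Import numFieldNormedType.Exports.
Local Open Scope classical_set_scope.
Local Open Scope ring_scope.

Set Implicit Arguments.
Unset Strict Implicit.
Unset Printing Implicit Defensive.

(** * Elementary events and their effect on the configuration *)

Section ClockFinite.
Variable K : nat.

Definition clock_code (c : clock K) : 'I_K + upair K + 'I_K :=
  match c with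
  | MoveClock i => inl (inl i)
  | GameClock p => inl (inr p)
  | BirthClock i => inr i
  end.

Definition clock_decode (y : 'I_K + upair K + 'I_K) : clock K :=
  match y with
  | inl (inl i) => MoveClock i
  | inl (inr p) => GameClock p
  | inr i => BirthClock i
  end.

Lemma clock_codeK : cancel clock_code clock_decode.
Proof. by case. Qed.

HB.instance Definition _ := Finite.copy (clock K) (can_type clock_codeK).
End ClockFinite.

Section Strategies.
Variables (R : realType) (m K : nat) (w0 wc : R) (g : payoffs R).
Hypotheses (w0_gt0 : 0 < w0) (w0wc : w0 < wc).
Hypotheses (reward_gt0 : 0 < reward g) (temptation_gt0 : 0 < temptation g)
  (sucker_gt0 : 0 < sucker g).
Context (disp : measure_display) (Om : measurableType disp).
Variables (X : noise R K Om) (w : Om).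
Hypothesis child_in :
  forall i n (A : {set 'I_K}), A != finset.set0 -> child X i n A w \in A.

Local Notation config := (config R m K).
Local Notation effect := (ring_effect w0 wc g X w).

Definition defector_alive (s : config) :=
  exists j, strat (s j) = Defector /\ 0 < wealth (s j).

Lemma ord_neq_upair (p : upair K) : (val p).2 != (val p).1.
Proof. by case: p => -[a b] /= ab; rewrite -val_eqE /= gtn_eqF. Qed.

(** A parent is richer than [wc], hence stays alive after giving [w0], and a child only replaces an
    unborn particle. In a game a defector loses only to another defector, who then loses nothing. *)
Lemma effect_defector c n (s : config) :
  defector_alive s -> defector_alive (effect c n s).
Proof.
move=> [j [sj wj]]; case: c => [i|p|i] /=.
- by exists j; rewrite /do_move; case: eqP => [<-|] //=.
- rewrite /do_game; case: ifP => [|_]; last by exists j.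
  case/and3P=> _ /andP[w1 u1] /andP[w2 u2].
  have ne := ord_neq_upair p.
  case: (eqVneq j (val p).1) => [ej|j1].
    subst j; rewrite sj.
    case e2: (strat (s (val p).2)) u2 => //= _.
      exists (val p).1; rewrite eqxx /=; split => //; exact: addr_gt0.
    (* Two defectors: the coin names the loser, and the other one, whose payoff is 0, is the
       witness. *)
    case: ifP => _ /=.
      by exists (val p).2; rewrite (negbTE ne) eqxx /= addr0.
    by exists (val p).1; rewrite eqxx /= addr0.
  case: (eqVneq j (val p).2) => [ej|j2]; last first.
    by exists j; rewrite (negbTE j1) (negbTE j2).
  subst j; rewrite sj.
  case e1: (strat (s (val p).1)) u1 => //= _.
    by exists (val p).2; rewrite (negbTE ne) eqxx /=; split => //; exact: addr_gt0.
  case: ifP => _ /=.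
    by exists (val p).2; rewrite (negbTE ne) eqxx /= addr0.
  by exists (val p).1; rewrite eqxx /= addr0.
- rewrite /do_birth; case: ifP => [|_]; last by exists j.
  case/and3P=> ui wi un0; exists j.
  have := child_in i n un0; set k := child _ _ _ _ _; rewrite inE => uk.
  have -> : (j == k) = false.
    by apply/negP => /eqP jk; move: uk; rewrite -jk sj.
  case: eqP => [ji|//] /=; split; first by rewrite -ji.
  by rewrite subr_gt0 (lt_trans w0wc).
Qed.

Definition is_game (c : clock K) : bool :=
  if c is GameClock _ then true else false.

(** The reward is charged to every ring of a game clock, whether or not [i] plays, so that only the
    total number of these rings matters later. A cooperator is never chosen as a child, hence death
    is final. *)
Lemma effect_cooperator c n (s : config) i : strat (s i) = Cooperator ->
  [/\ strat (effect c n s i) = Cooperator,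
      wealth (effect c n s i) <= wealth (s i) + reward g *+ is_game c &
      wealth (s i) <= 0 -> wealth (effect c n s i) <= 0].
Proof.
move=> si; case: c => [k|p|k] /=.
- by rewrite /do_move addr0; case: eqP => [<-|] /=.
- have le0 : wealth (s i) <= wealth (s i) + reward g by rewrite lerDl ltW.
  rewrite mulr1n /do_game; case: ifP => [|_ //].
  case/and3P=> _ /andP[w1 u1] /andP[w2 u2].
  case: eqP => [ei|_].
    subst i; rewrite si /= [_ <= 0]leNgt w1; split => //.
    case: (strat (s (val p).2)) u2 => //= _; rewrite lerD2l //.
    by rewrite (le_trans _ (ltW reward_gt0)) // oppr_le0 ltW.
  case: eqP => [ei|_ //].
  subst i; rewrite si /= [_ <= 0]leNgt w2; split => //.
  case: (strat (s (val p).1)) u1 => //= _; rewrite lerD2l //.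
  by rewrite (le_trans _ (ltW reward_gt0)) // oppr_le0 ltW.
- rewrite addr0 /do_birth; case: ifP => [|_ //].
  case/and3P=> uk wk un0.
  have := child_in k n un0; set j := child _ _ _ _ _; rewrite inE => uj.
  have -> : (i == j) = false.
    by apply/negP => /eqP ij; move: uj; rewrite -ij si.
  case: eqP => [ik|//] /=; subst k.
  have le1 : wealth (s i) - w0 <= wealth (s i) by rewrite gerBl ltW.
  by split => // /(le_trans le1).
Qed.

Definition involves (i : 'I_K) (c : clock K) : bool :=
  match c with
  | MoveClock k => k == i
  | GameClock p => ((val p).1 == i) || ((val p).2 == i)
  | BirthClock _ => false
  end.

(** Among the clocks that involve [i], only that of the game of [i] with [j] can change [j], and
    this game pays [temptation] to [j]. *)
Lemma effect_bystander c n (s : config) i j :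
  involves i c -> strat (s i) = Cooperator -> i != j ->
  strat (s j) = Defector -> 0 < wealth (s j) ->
  [/\ position (effect c n s j) = position (s j),
      strat (effect c n s j) = Defector & 0 < wealth (effect c n s j)].
Proof.
case: c => [k|p|k] //= ic si ij sj wj.
- by move/eqP: ic => ->; rewrite /do_move eq_sym (negbTE ij).
- rewrite /do_game; case: ifP => [|_ //].
  case/and3P=> _ _ _; have ne := ord_neq_upair p.
  case/orP: ic => /eqP ei; subst i.
    rewrite eq_sym (negbTE ij); case: eqP => [ej|//].
    by subst j; rewrite si sj /=; split=> //; exact: addr_gt0.
  case: eqP => [ej|_]; last by rewrite eq_sym (negbTE ij).
  by subst j; rewrite si sj /=; split=> //; exact: addr_gt0.
Qed.

Lemma effect_position c n (s : config) i : involves i c ->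
  position (effect c n s i) =
    if c is MoveClock k then torus_step (direction X k n w) (position (s i))
    else position (s i).
Proof.
case: c => [k|p|k] //= => [/eqP ->|_].
  by rewrite /do_move eqxx.
rewrite /do_game; case: ifP => [|_ //]; case/and3P=> /eqP e _ _.
case: eqP => [->//|_]; by case: eqP => [->|_].
Qed.

Lemma effect_meeting (p : upair K) n (s : config) i j :
  involves i (GameClock p) -> involves j (GameClock p) -> i != j ->
  strat (s i) = Cooperator -> strat (s j) = Defector ->
  0 < wealth (s i) -> 0 < wealth (s j) -> position (s i) = position (s j) ->
  wealth (effect (GameClock p) n s i) = wealth (s i) - sucker g.
Proof.
move=> /= ip jp ij si sj wi wj pij; have ne := ord_neq_upair p.
rewrite /do_game.
case/orP: ip => /eqP ei; case/orP: jp => /eqP ej.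
- by move: ij; rewrite -ei -ej eqxx.
- by subst i j; rewrite /can_play wi wj si sj pij eqxx /= eqxx.
- by subst i j; rewrite /can_play wi wj si sj -pij eqxx /= (negbTE ij) eqxx.
- by move: ij; rewrite -ei -ej eqxx.
Qed.

End Strategies.

(** * The script *)

Section Tour.
Variable m : nat.

Lemma val_iter_ordS (a : 'I_m) k : val (iter k (@ordS m) a) = ((a + k) %% m)%N.
Proof.
elim: k => [|k IH] /=; first by rewrite addn0 modn_small.
by rewrite [nat_of_ord _]IH -addn1 modnDml addn1 addnS.
Qed.

Lemma iter_ordS_order (a : 'I_m) : iter m (@ordS m) a = a.
Proof. by apply: val_inj; rewrite val_iter_ordS modnDr modn_small. Qed.

Lemma ordS_connected (a b : 'I_m) : exists2 k, (k < m)%N & iter k (@ordS m) a = b.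
Proof.
have m_gt0 : (0 < m)%N by case: m a => [[]|].
exists ((b + (m - a)) %% m)%N; first by rewrite ltn_mod.
apply: val_inj; rewrite val_iter_ordS modnDmr addnCA subnKC ?modnDr ?modn_small //.
exact: ltnW.
Qed.

(** At least one step is required because a visit is the end of a move; a full turn serves when [a]
    is already the target. *)
Lemma ordS_connectedS (a b : 'I_m) :
  exists2 k, (k < m)%N & iter k.+1 (@ordS m) a = b.
Proof.
have [k km <-] := ordS_connected (ordS a) b.
by exists k => //; rewrite iterSr.
Qed.

Definition walk : 'I_m * 'I_m -> seq (bool * bool) -> 'I_m * 'I_m :=
  foldl (fun x e => torus_step e x).

(** A full turn along the second coordinate, back to the start, then one step along the first. *)
Definition tour_row : seq (bool * bool) :=
  rcons (nseq m (true, true)) (false, true).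

Definition tour : seq (bool * bool) := flatten (nseq m tour_row).

Lemma walk_column k x : walk x (nseq k (true, true)) = (x.1, iter k (@ordS m) x.2).
Proof.
elim: k x => [|k IH] x /=; first by case: x.
by rewrite IH /= -iterSr.
Qed.

Lemma walk_rows k x :
  walk x (flatten (nseq k tour_row)) = (iter k (@ordS m) x.1, x.2).
Proof.
elim: k x => [|k IH] x /=; first by case: x.
rewrite /walk foldl_cat -/walk IH /tour_row -cats1 /walk foldl_cat -/walk walk_column /=.
by rewrite iter_ordS_order -iterSr.
Qed.

(** Whole rows adjust the first coordinate, then part of a row adjusts the second. The site is
    reached at the end of the move [e], which is where the script inserts its games. *)
Lemma tour_visits (x y : 'I_m * 'I_m) : exists e1 e e2,
  tour = e1 ++ e :: e2 /\ walk x (rcons e1 e) = y.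
Proof.
have [k km ek] := ordS_connected x.1 y.1.
have [l lm el] := ordS_connectedS x.2 y.2.
exists (flatten (nseq k tour_row) ++ nseq l (true, true)), (true, true),
  (nseq (m - l.+1) (true, true) ++ (false, true) :: flatten (nseq (m - k.+1) tour_row)).
split.
  rewrite /tour -[in nseq m _](subnKC (ltnW km)) nseqD flatten_cat -catA.
  congr (_ ++ _); rewrite -(subnSK km) /= /tour_row -cats1.
  rewrite -[in nseq m _](subnKC lm) nseqD -!catA.
  by rewrite -[l.+1]addn1 nseqD -catA.
rewrite -cats1 -catA /walk foldl_cat -/walk walk_rows.
by rewrite -[[:: _]]/(nseq 1 _) -nseqD addn1 walk_column /= -iterS ek el -surjective_pairing.
Qed.

End Tour.

Section Script.
Variables (m K : nat).

(* The directions attached to the rings of game clocks are irrelevant. *)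
Definition script (i : 'I_K) : seq (clock K * (bool * bool)) :=
  flatten [seq (MoveClock i, e) ::
             [seq (GameClock p, e) | p <- enum {: upair K}
                                   & involves i (GameClock p)]
          | e <- tour m].

Lemma script_involves i ce : ce \in script i -> involves i ce.1.
Proof.
case/flattenP => _ /mapP[e _ ->]; rewrite inE => /orP[/eqP -> /=|]; first exact: eqxx.
by case/mapP => p; rewrite mem_filter => /andP[ip _] ->.
Qed.

Definition script_walk : 'I_m * 'I_m -> seq (clock K * (bool * bool)) -> 'I_m * 'I_m :=
  foldl (fun x ce => if ce.1 is MoveClock _ then torus_step ce.2 x else x).

Lemma script_walk_games x e (ps : seq (upair K)) :
  script_walk x [seq (GameClock p, e) | p <- ps] = x.
Proof. by elim: ps. Qed.

Lemma script_walkE x i es :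
  script_walk x (flatten [seq (MoveClock i, e) ::
             [seq (GameClock p, e) | p <- enum {: upair K}
                                   & involves i (GameClock p)]
          | e <- es]) = walk x es.
Proof.
elim: es x => [//|e es IH] x /=.
by rewrite {1}/script_walk foldl_cat -/script_walk script_walk_games IH.
Qed.

Lemma upair_of (i j : 'I_K) : i != j ->
  exists p : upair K, involves i (GameClock p) && involves j (GameClock p).
Proof.
rewrite neq_ltn => /orP[] h.
  by exists (exist _ (i, j) h); rewrite /= !eqxx orbT.
by exists (exist _ (j, i) h); rewrite /= !eqxx orbT.
Qed.

(** To be used with the sites [x] of [i] and [y] of [j] at the beginning of a window. Some move of
    the tour ends at [y], and the block of games after it contains the pair of [i] and [j]. *)
Lemma script_meets (i j : 'I_K) (x y : 'I_m * 'I_m) : i != j ->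
  exists p u, [/\ (u < size (script i))%N,
    (nth (BirthClock i, (true, true)) (script i) u).1 = GameClock p,
    involves i (GameClock p), involves j (GameClock p) &
    script_walk x (take u (script i)) = y].
Proof.
move=> ij; have [p /andP[ip jp]] := upair_of ij.
have [e1 [e [e2 [tourE walkE]]]] := tour_visits x y.
have pL : p \in [seq q <- enum {: upair K} | involves i (GameClock q)].
  by rewrite mem_filter ip mem_enum.
have [p1 [p2 pE]] : exists p1 p2,
    [seq q <- enum {: upair K} | involves i (GameClock q)] = p1 ++ p :: p2.
  by case/splitPr: pL => p1 p2; exists p1, p2.
pose games e := [seq (GameClock q, e : bool * bool)
  | q <- enum {: upair K} & involves i (GameClock q)].
(* The slots before the meeting: the blocks of the earlier moves, the move that reaches [y], and the
   games of its block that precede [p]. *)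
pose pre := flatten [seq (MoveClock i, e) :: games e | e <- e1] ++
  (MoveClock i, e) :: [seq (GameClock q, e) | q <- p1].
pose post := [seq (GameClock q, e) | q <- p2] ++
  flatten [seq (MoveClock i, e) :: games e | e <- e2].
have scriptE : script i = pre ++ (GameClock p, e) :: post.
  rewrite /script tourE map_cat flatten_cat /= -/(games _) /pre -catA.
  by congr (_ ++ _ :: _); rewrite /post /games pE map_cat -!catA.
exists p, (size pre); rewrite scriptE; split => //.
- by rewrite size_cat /= addnS ltnS leq_addr.
- by rewrite nth_cat ltnn subnn.
rewrite take_size_cat // /pre /script_walk foldl_cat -/script_walk script_walkE /=.
by rewrite script_walk_games -walkE -cats1 /walk foldl_cat.
Qed.
End Script.

(** * Trajectories *)

Section Rings.
Variables (R : realType) (K : nat).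
Context (disp : measure_display) (Om : measurableType disp).
Variables (X : noise R K Om).

Definition ring_free (s t : R) (w : Om) :=
  forall c, ring_count X c t w = ring_count X c s w.

Definition one_ring (c : clock K) (s t : R) (w : Om) :=
  ring_count X c t w = (ring_count X c s w).+1 /\
  forall c', c' <> c -> ring_count X c' t w = ring_count X c' s w.

Definition lone_ring (s t : R) (w : Om) :=
  ring_free s t w \/ exists c, one_ring c s t w.

Definition heeds (ce : clock K * (bool * bool)) (n : nat) (w : Om) :=
  if ce.1 is MoveClock k then direction X k n w = ce.2 else True.

(** Slot [u] is the time interval from [n0 + u] to [n0 + u + 1]. Rings being numbered from 0, the
    count at its beginning is the number of the ring that it contains. *)
Definition obeys (n0 : nat) (cs : seq (clock K * (bool * bool))) (w : Om) :=
  forall u ce0, (u < size cs)%N ->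
    let ce := nth ce0 cs u in
    one_ring ce.1 (n0 + u)%:R (n0 + u).+1%:R w /\
    heeds ce (ring_count X ce.1 (n0 + u)%:R w) w.

Definition game_rings (t : R) (w : Om) : nat :=
  (\sum_(p : upair K) ring_count X (GameClock p) t w)%N.

End Rings.

Section Trajectory.
Variables (R : realType) (m K : nat) (w0 wc : R) (g : payoffs R).
Hypotheses (w0_gt0 : 0 < w0) (w0wc : w0 < wc).
Hypotheses (reward_gt0 : 0 < reward g) (temptation_gt0 : 0 < temptation g)
  (sucker_gt0 : 0 < sucker g).
Context (disp : measure_display) (Om : measurableType disp).
Variables (X : noise R K Om) (w : Om) (s0 : config R m K) (x : R -> config R m K).
Hypothesis traj : dpd_trajectory w0 wc g s0 X w x.
Hypothesis child_in :
  forall i n (A : {set 'I_K}), A != finset.set0 -> child X i n A w \in A.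
Hypothesis rings_nondecreasing : forall c (s t : R), 0 <= s -> s <= t ->
  (ring_count X c s w <= ring_count X c t w)%N.
Hypothesis fine_mesh : forall T : nat, exists l : nat, forall u,
  (u < T * 2 ^ l)%N ->
  lone_ring X (u%:R / (2 ^ l)%:R) (u.+1%:R / (2 ^ l)%:R) w.

Local Notation N c t := (ring_count X c t w).

Lemma lone_ring_sub (s s' t' t : R) : 0 <= s -> s <= s' -> s' <= t' -> t' <= t ->
  lone_ring X s t w -> lone_ring X s' t' w.
Proof.
move=> h0 h1 h2 h3; have h4 := le_trans h0 h1; have h5 := le_trans h4 h2.
have le3 c : [/\ (N c s <= N c s')%N, (N c s' <= N c t')%N & (N c t' <= N c t)%N].
  by split; exact: rings_nondecreasing.
move=> [free|[c [cr cf]]].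
  left=> c; have [a1 a2 a3] := le3 c; apply/eqP.
  by rewrite eqn_leq a2 andbT (leq_trans a3) ?free.
have [a1 a2 a3] := le3 c.
have cf' c' : c' <> c -> N c' t' = N c' s'.
  move=> /cf e; have [b1 b2 b3] := le3 c'; apply/eqP.
  by rewrite eqn_leq b2 andbT (leq_trans b3) ?e.
case: (eqVneq (N c t') (N c s')) => [e|ne].
  by left=> c'; case: (eqVneq c' c) => [->//|/eqP/cf'].
right; exists c; split=> //; apply/eqP; rewrite eqn_leq (leq_trans a3) ?cr //=.
by rewrite ltn_neqAle eq_sym ne.
Qed.

(** This replaces induction on the successive rings: an interval is cut along a dyadic mesh whose
    cells contain at most one ring each, and [Q] is composed over the pieces. *)
Lemma lone_chain (Q : R -> R -> Prop) :
  (forall s t u, 0 <= s -> s <= t -> t <= u -> Q s t -> Q t u -> Q s u) ->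
  (forall s t, 0 <= s -> s <= t -> lone_ring X s t w -> Q s t) ->
  forall s t, 0 <= s -> s <= t -> Q s t.
Proof.
move=> Qtrans Qlone s t s_ge0 st.
have [T tT0] : exists T : nat, t <= T%:R.
  by exists (Num.Def.truncn t).+1; rewrite ltW // truncnS_gt.
have [l lP] := fine_mesh T.
have h_gt0 : 0 < (2 ^ l)%:R :> R by rewrite ltr0n expn_gt0.
have tT : t <= (T * 2 ^ l)%:R / (2 ^ l)%:R.
  by rewrite natrM mulfK ?gt_eqF.
clear tT0.
suff main n : (n <= T * 2 ^ l)%N -> forall s t, 0 <= s -> s <= t ->
    t <= n%:R / (2 ^ l)%:R -> Q s t by exact: (main (T * 2 ^ l)%N).
elim: n {s t s_ge0 st tT} => [|n IH] nT s t s_ge0 st tn.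
  apply: Qlone => //; left => c.
  have t0 : t <= 0 by move: tn; rewrite mul0r.
  by have -> : s = t by lra.
(* Either [t] is not beyond the left end of the last cell, or [s] and [t] both lie in this cell, or
   the interval is split at its left end. *)
case: (lerP t (n%:R / (2 ^ l)%:R)) => tn'.
  by apply: IH => //; exact: ltnW.
have cell := lP n nT.
have n_ge0 : 0 <= n%:R / (2 ^ l)%:R :> R by rewrite divr_ge0 ?ler0n.
case: (lerP (n%:R / (2 ^ l)%:R) s) => sn.
  by apply: Qlone => //; apply: lone_ring_sub cell.
apply: (Qtrans s (n%:R / (2 ^ l)%:R) t) => //; try exact: ltW.
  by apply: IH => //; [exact: ltnW|exact: ltW].
apply: Qlone => //; first exact: ltW.
by apply: lone_ring_sub cell => //; exact: ltW.
Qed.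

Lemma one_ringE c s t : 0 <= s -> s <= t -> one_ring X c s t w ->
  x t = ring_effect w0 wc g X w c (N c s) (x s).
Proof. by move=> h1 h2 [h3 h4]; apply: (trajectory_ring traj). Qed.

Lemma defector_alive_persists s t : 0 <= s -> s <= t ->
  defector_alive (x s) -> defector_alive (x t).
Proof.
move: s t; apply: lone_chain => [s t u _ _ _ h1 h2 /h1 /h2 //|s t h1 h2].
move=> [free|[c cr]]; first by rewrite (trajectory_constant traj h1 h2 free).
by rewrite (one_ringE h1 h2 cr); exact: effect_defector.
Qed.

Lemma one_ring_games c s t : one_ring X c s t w ->
  game_rings X t w = (game_rings X s w + is_game c)%N.
Proof.
move=> [cr cf]; rewrite /game_rings; case: c cr cf => [i|p|i] cr cf /=.
- by rewrite addn0; apply: eq_bigr => q _; rewrite cf.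
- rewrite (bigD1 p) //= [in RHS](bigD1 p) //= cr addn1 addSn; congr (_ + _).+1.
  apply: eq_bigr => q /eqP qp; rewrite cf // => -[] /esym; exact/nesym.
- by rewrite addn0; apply: eq_bigr => q _; rewrite cf.
Qed.

(** With the game counts on both sides rather than their difference, the inequality composes by
    addition, as [lone_chain] requires. *)
Lemma cooperator_evolution i s t : 0 <= s -> s <= t ->
  strat (x s i) = Cooperator ->
  [/\ strat (x t i) = Cooperator,
      wealth (x t i) + reward g *+ game_rings X s w <=
        wealth (x s i) + reward g *+ game_rings X t w &
      wealth (x s i) <= 0 -> wealth (x t i) <= 0].
Proof.
move: s t; apply: lone_chain => [s t u _ _ _ h1 h2 /h1 [s1 w1 d1]|s t h1 h2].
  have [s2 w2 d2] := h2 s1; split=> // [|/d1/d2//]; lra.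
move=> [free|[c cr]] si.
  rewrite (trajectory_constant traj h1 h2 free) /game_rings; split => //.
  by under [in leRHS]eq_bigr do rewrite free.
rewrite (one_ringE h1 h2 cr) (one_ring_games cr).
have [e1 e2 e3] := effect_cooperator wc w0_gt0 reward_gt0 sucker_gt0 child_in c (N c s) si.
by split=> //; rewrite mulrnDr; lra.
Qed.

(** If the first alternative fails, [i] is a living cooperator at some time; were it dead later, it
    would stay dead and the first alternative would hold. An integer [n0] is chosen because the
    slots of a script begin at integer times. *)
Lemma cooperator_fate i :
  (exists2 t0 : R, 0 <= t0 & forall t, t0 <= t ->
     strat (x t i) = Cooperator -> wealth (x t i) <= 0) \/
  exists n0 : nat, forall t, n0%:R <= t ->
     strat (x t i) = Cooperator /\ 0 < wealth (x t i).
Proof.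
have [h|h] := pselect (exists2 t0 : R, 0 <= t0 & forall t, t0 <= t ->
     strat (x t i) = Cooperator -> wealth (x t i) <= 0); [by left|right].
have /existsNP[t1] : ~ (forall t : R, 0 <= t -> strat (x t i) = Cooperator ->
    wealth (x t i) <= 0).
  by move=> h'; apply: h; exists 0.
move=> /not_implyP[t1_ge0 /not_implyP[s1 /negP]]; rewrite -ltNge => wl1.
exists (Num.Def.truncn t1).+1 => t t1t.
have {}t1t : t1 <= t by apply: le_trans t1t; rewrite ltW // truncnS_gt.
have [st _ _] := cooperator_evolution t1_ge0 t1t s1; split=> //.
rewrite ltNge; apply/negP => wt; apply: h; exists t; first exact: le_trans t1t.
move=> u tu su.
have [_ _] := cooperator_evolution (le_trans t1_ge0 t1t) tu st; exact.
Qed.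

Section Window.
Variables (i : 'I_K) (n0 : nat).
Hypothesis alive : forall t, n0%:R <= t ->
  strat (x t i) = Cooperator /\ 0 < wealth (x t i).
Hypothesis defector0 : defector_alive s0.

(** Every ring of the script involves [i], so that [effect_bystander] protects [j] slot after slot,
    while [i] follows the prescribed walk. *)
Lemma script_run (n : nat) j u : (n0 <= n)%N -> obeys X n (script m i) w ->
  i != j -> strat (x n%:R j) = Defector -> 0 < wealth (x n%:R j) ->
  (u <= size (script m i))%N ->
  [/\ position (x (n + u)%:R j) = position (x n%:R j),
      strat (x (n + u)%:R j) = Defector, 0 < wealth (x (n + u)%:R j) &
      position (x (n + u)%:R i) = script_walk (position (x n%:R i)) (take u (script m i))].
Proof.
move=> n0n ob ij sj wj; elim: u => [|u IH] ul; first by rewrite addn0 take0.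
have [p1 p2 p3 p4] := IH (ltnW ul).
have [] := ob u (BirthClock i, (true, true)) ul.
have ce_in := mem_nth (BirthClock i, (true, true)) ul.
have := script_involves ce_in.
move: (nth _ _ _) (take_nth (BirthClock i, (true, true)) ul) => -[c e] /= takeE ic cr hd.
have hle : (n + u)%:R <= (n + u).+1%:R :> R by rewrite ler_nat.
have [si _] : strat (x (n + u)%:R i) = Cooperator /\ 0 < wealth (x (n + u)%:R i).
  by apply: alive; rewrite ler_nat (leq_trans n0n) ?leq_addr.
rewrite addnS (one_ringE _ hle cr) //.
have [q1 q2 q3] := effect_bystander w0 wc temptation_gt0 X w (N c (n + u)%:R) ic si ij p2 p3.
rewrite q1 q2 q3 p1; split=> //.
rewrite effect_position // p4 takeE -cats1 /script_walk foldl_cat /=.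
by case: c {takeE ic cr q1 q2 q3} hd => //= k; rewrite /heeds /= => ->.
Qed.

(** A defector alive at the beginning of the window is met in some slot [u]. The payment there is
    combined with [cooperator_evolution] before and after this slot. *)
Lemma obeyed_drop (n : nat) : (n0 <= n)%N -> obeys X n (script m i) w ->
  wealth (x (n + size (script m i))%:R i) + sucker g + reward g *+ game_rings X n%:R w
  <= wealth (x n%:R i) + reward g *+ game_rings X (n + size (script m i))%:R w.
Proof.
move=> n0n ob.
have aliveN k : strat (x (n + k)%:R i) = Cooperator /\ 0 < wealth (x (n + k)%:R i).
  by apply: alive; rewrite ler_nat (leq_trans n0n) ?leq_addr.
have [j [sj wj]] : defector_alive (x n%:R).
  apply: (@defector_alive_persists 0); rewrite ?ler0n //.
  by rewrite (trajectory_start traj).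
have ij : i != j.
  by apply/eqP => ij; have [] := aliveN 0%N; rewrite addn0 ij sj.
have [p [u [ul cE ip jp walkE]]] :=
  script_meets (position (x n%:R i)) (position (x n%:R j)) ij.
have [p1 p2 p3 p4] := script_run n0n ob ij sj wj (ltnW ul).
have [cr _] := ob u (BirthClock i, (true, true)) ul.
rewrite cE in cr.
have hle : (n + u)%:R <= (n + u).+1%:R :> R by rewrite ler_nat.
have hle1 : n%:R <= (n + u)%:R :> R by rewrite ler_nat leq_addr.
have hle2 : (n + u).+1%:R <= (n + size (script m i))%:R :> R.
  by rewrite ler_nat -addnS leq_add2l.
have [su wu] := aliveN u; have [sn _] := aliveN 0%N; rewrite addn0 in sn.
have := one_ringE (ler0n _ _) hle cr => xE.
have drop : wealth (x (n + u).+1%:R i) = wealth (x (n + u)%:R i) - sucker g.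
  by rewrite xE; apply: (effect_meeting _ _ _ _ _ _ ip jp) => //; rewrite p4 p1.
have gE := one_ring_games cr.
have [_ b1 _] := cooperator_evolution (ler0n _ _) hle1 sn.
have [su' _] := aliveN u.+1; rewrite addnS in su'.
have [_ b2 _] := cooperator_evolution (ler0n _ _) hle2 su'.
(* The ring of the meeting is itself counted as a game, which leaves a slack of one reward; its sign
   closes the inequality. *)
have := reward_gt0.
by move: b1 b2; rewrite drop gE mulrnDr /=; lra.
Qed.

(** The windows follow one another from [n0]. Those without a script only contribute the bound on
    gains, and the wealth left at the end is positive. *)
Lemma obeyed_drops (k : nat) :
  sucker g *+ (\sum_(n < k) `[< obeys X (n0 + n * size (script m i)) (script m i) w >])%N
  < wealth (x n0%:R i) + reward g *+ game_rings X (n0 + k * size (script m i))%:R w.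
Proof.
set L := size (script m i).
suff : wealth (x (n0 + k * L)%:R i) +
    sucker g *+ (\sum_(n < k) `[< obeys X (n0 + n * L) (script m i) w >])%N
    + reward g *+ game_rings X n0%:R w
  <= wealth (x n0%:R i) + reward g *+ game_rings X (n0 + k * L)%:R w.
  have [_ h1] : strat (x (n0 + k * L)%:R i) = Cooperator /\
      0 < wealth (x (n0 + k * L)%:R i).
    by apply: alive; rewrite ler_nat leq_addr.
  have : 0 <= reward g *+ game_rings X n0%:R w by rewrite mulrn_wge0 // ltW.
  lra.
elim: k => [|k IH]; first by rewrite big_ord0 mul0n addn0 mulr0n addr0.
rewrite big_ord_recr /= [sucker g *+ (_ + _)]mulrnDr mulSn addnCA [(L + _)%N]addnC.
set a := (n0 + k * L)%N in IH *.
have [ob|nob] := asboolP (obeys X a (script m i) w).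
  by have := obeyed_drop (leq_addr _ _) ob; rewrite -/L -/a mulr1n; lra.
have hle : a%:R <= (a + L)%:R :> R by rewrite ler_nat leq_addr.
have [sa _] : strat (x a%:R i) = Cooperator /\ 0 < wealth (x a%:R i).
  by apply: alive; rewrite ler_nat leq_addr.
have [_ b _] := cooperator_evolution (ler0n _ _) hle sa.
by move: b IH; rewrite mulr0n; lra.
Qed.

End Window.
End Trajectory.

(** * Tools from probability *)

Section Measurability.
Context (d : measure_display) (T : measurableType d).

Lemma measurable_nat_fun2 (f g : T -> nat) (Q : nat -> nat -> Prop) :
  (forall n, measurable (f @^-1` [set n])) ->
  (forall n, measurable (g @^-1` [set n])) ->
  measurable [set t | Q (f t) (g t)].
Proof.
move=> mf mg.
have -> : [set t | Q (f t) (g t)] =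
    \bigcup_a \bigcup_(b in [set b | Q a b]) (f @^-1` [set a] `&` g @^-1` [set b]).
  apply/seteqP; split => t /=.
    by move=> h; exists (f t) => //; exists (g t).
  by move=> [a _ [b Qab [/= -> ->]]].
apply: bigcup_measurable => a _; apply: bigcup_measurable => b _.
exact: measurableI.
Qed.

Lemma measurable_bigcap_fin (I : finType) (A : I -> set T) :
  (forall i, measurable (A i)) -> measurable (\bigcap_i A i).
Proof. by move=> mA; apply: fin_bigcap_measurable => // i _. Qed.

Lemma measurable_bigcup_fin (I : finType) (A : I -> set T) :
  (forall i, measurable (A i)) -> measurable (\bigcup_i A i).
Proof. by move=> mA; apply: fin_bigcup_measurable => // i _. Qed.

End Measurability.

Section ProbabilityTools.
Context (d : measure_display) (T : measurableType d) (R : realType).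
Variable P : probability T R.

Lemma independent_classes_fin (I : Type) (F : I -> set (set T)) (J : finType)
    (s : J -> I) (A : J -> set T) :
  independent_classes P F -> injective s -> (forall j, F (s j) (A j)) ->
  (P (\bigcap_j A j) = \prod_(j : J) P (A j))%E.
Proof.
move=> ind sI FA.
have -> : \bigcap_j A j = \bigcap_(k : 'I_#|J|) A (enum_val k).
  apply/seteqP; split => t /= h j _; first exact: h.
  by rewrite -(enum_rankK j); exact: h.
rewrite (ind _ (s \o enum_val) (A \o enum_val)).
- by rewrite (reindex _ (onW_bij _ (@enum_val_bij J))).
- by move=> k l /sI/enum_val_inj.
- by move=> k; exact: FA.
Qed.

(** Total probability over the values of [f], numbered by [pickle]; a number that codes no value
    gives an empty piece. *)
Lemma countable_split (V : countType) (f : T -> V) (E E' : set T) (q : R) :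
  (forall a, measurable (f @^-1` [set a])) -> measurable E -> measurable E' ->
  0 <= q ->
  (forall a, P (E `&` f @^-1` [set a]) = q%:E * P (E' `&` f @^-1` [set a]))%E ->
  (P E = q%:E * P E')%E.
Proof.
move=> mf mE mE' q_ge0 PE.
pose h k := [set t | pickle (f t) = k].
have hE k : h k = set0 \/ exists a, h k = f @^-1` [set a].
  case: (pselect (exists a : V, pickle a = k)) => [[a ak]|no].
    right; exists a; apply/seteqP; split => t /=; rewrite /h /= -ak.
      by move/(pcan_inj pickleK).
    by move=> ->.
  left; apply/seteqP; split => t //= hk; apply: no; by exists (f t).
have mh k : measurable (h k) by case: (hE k) => [->|[a ->]].
have split_h B : measurable B -> P B = (\sum_(k <oo) P (B `&` h k))%E.
  move=> mB; transitivity (P (\bigcup_k (B `&` h k))).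
    congr (P _); apply/seteqP; split => t /=; last by move=> [k _ []].
    by move=> Bt; exists (pickle (f t)).
  rewrite measure_bigcup //; first by apply: eq_eseriesl => k; rewrite in_setT.
    by move=> k _; exact: measurableI.
  apply/trivIsetP => a b _ _ ab; apply/seteqP; split => t //=.
  by move=> [[_ ha] [_ hb]]; move: ab; rewrite -ha -hb eqxx.
rewrite (split_h E mE) (split_h E' mE') -nneseriesZl //; apply: eq_eseriesr => k _.
by case: (hE k) => [->|[a ->]] //; rewrite !setI0 measure0 mule0.
Qed.

Lemma integral_sum_indic (J : Type) (s : seq J) (B : J -> set T) :
  (forall j, measurable (B j)) ->
  (\int[P]_t (\sum_(j <- s) (\1_(B j) t : R))%:E = \sum_(j <- s) P (B j))%E.
Proof.
move=> mB; under eq_integral do rewrite -sumEFin.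
have mI j : measurable_fun setT (fun t => (\1_(B j) t : R)%:E).
  by apply/measurable_EFinP; exact: measurable_indic.
rewrite (ge0_integral_sum P measurableT mI); last first.
  by move=> j t _; rewrite lee_fin indicE ler0n.
by apply: eq_bigr => j _; rewrite integral_indic // setIT.
Qed.

Definition few_hits (A : nat -> set T) (e : R) (n : nat) : set T :=
  [set t | ((\sum_(k < n) `[< A k t >])%N%:R <= e * n%:R / 2)%R].

(** Pairwise independence gives the number of hits the variance [n e (1 - e)], at most its mean
    [c = n e]. A deviation of [c / 2] then has probability at most [c / (c / 2) ^ 2 = 4 / c]. *)
Lemma pairwise_chebyshev (A : nat -> set T) (e : R) (n : nat) :
  (forall k, measurable (A k)) -> (forall k, P (A k) = e%:E) ->
  (forall k l, k != l -> P (A k `&` A l) = (e ^+ 2)%:E) -> 0 < e -> (0 < n)%N ->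
  measurable (few_hits A e n) /\
  (P (few_hits A e n) <= (4 / (e * n%:R))%:E)%E.
Proof.
move=> mA PA PAA e_gt0 n_gt0.
pose S t : R := \sum_(k < n) \1_(A k) t.
have SE t : (\sum_(k < n) `[< A k t >])%N%:R = S t.
  by rewrite natr_sum; apply: eq_bigr => k _; rewrite indicE.
have mS : measurable_fun setT S.
  by apply: measurable_sum => k; exact: measurable_indic.
set D := few_hits A e n.
have mD : measurable D.
  rewrite (_ : D = S @^-1` `]-oo, e * n%:R / 2]).
    by rewrite -[X in measurable X]setTI; exact: mS.
  by apply/seteqP; split => t /=; rewrite in_itv /D /few_hits /= SE.
split=> //.
set c := n%:R * e.
have c_gt0 : 0 < c by rewrite mulr_gt0 ?ltr0n.
have iS : (\int[P]_t (S t)%:E = c%:E)%E.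
  rewrite /S integral_sum_indic // (eq_bigr (fun=> e%:E)) => [|k _]; last exact: PA.
  by rewrite sumEFin sumr_const card_ord -mulr_natl.
(* There are [n] diagonal terms equal to [e] and [n (n - 1)] others equal to [e ^ 2]. *)
have iS2 : (\int[P]_t (S t ^+ 2)%:E = (c + (c ^+ 2 - n%:R * e ^+ 2))%:E)%E.
  have S2E t : S t ^+ 2 = \sum_(q : 'I_n * 'I_n) \1_(A q.1 `&` A q.2) t.
    rewrite expr2 /S mulr_suml -(pair_bigA _ (fun k l : 'I_n => \1_(A k `&` A l) t)) /=.
    apply: eq_bigr => k _; rewrite mulr_sumr.
    by apply: eq_bigr => l _; rewrite indicI.
  under eq_integral do rewrite S2E.
  rewrite integral_sum_indic; last by move=> q; exact: measurableI.
  rewrite -(pair_bigA _ (fun k l : 'I_n => P (A k `&` A l))) /=.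
  have inner (k : 'I_n) : (\sum_(l < n) P (A k `&` A l) =
      (e + n.-1%:R * e ^+ 2)%:E)%E.
    rewrite (bigD1 k) //= setIid PA (eq_bigr (fun=> (e ^+ 2)%:E)) => [|l lk].
      by rewrite sumEFin -EFinD sumr_const cardC1 card_ord mulr_natl.
    by rewrite PAA // eq_sym.
  rewrite (eq_bigr (fun=> (e + n.-1%:R * e ^+ 2)%:E)) => [|k _]; last exact: inner.
  rewrite sumEFin sumr_const card_ord -[_ *+ n]mulr_natl; congr (_%:E).
  have nE : n%:R = n.-1%:R + 1 :> R by rewrite natr1 prednK.
  by rewrite /c nE; ring.
have iV : (\int[P]_t ((S t - c) ^+ 2)%:E <= c%:E)%E.
  (* The square is expanded with the cross term on the left, so that only nonnegative functions are
     integrated. *)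
  have : (\int[P]_t (((S t - c) ^+ 2)%:E + (2 * c)%:E * (S t)%:E) =
      \int[P]_t ((S t ^+ 2)%:E + (c ^+ 2)%:E))%E.
    by apply: eq_integral => t _; rewrite -EFinM -!EFinD; congr (_%:E); ring.
  have S_ge0 t : 0 <= S t by rewrite sumr_ge0 // => k _; rewrite indicE ler0n.
  rewrite ge0_integralD //; last 4 first.
  - by move=> t _; rewrite lee_fin sqr_ge0.
  - apply/measurable_EFinP; apply: measurable_funX; apply: measurable_funB => //.
  - by move=> t _; rewrite -EFinM lee_fin !mulr_ge0 // ltW.
  - apply/measurable_EFinP; apply: measurable_funM => //.
  rewrite ge0_integralD //; last 3 first.
  - by move=> t _; rewrite lee_fin sqr_ge0.
  - by apply/measurable_EFinP; apply: measurable_funX.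
  - by move=> t _; rewrite lee_fin sqr_ge0.
  rewrite ge0_integralZl //; last 3 first.
  - exact/measurable_EFinP.
  - by move=> t _; rewrite lee_fin.
  - by rewrite lee_fin mulr_ge0 // ltW.
  rewrite iS iS2 integral_cst // [X in _ = (_ + _ * X)%E](probability_setT P) mule1 -EFinM -EFinD.
  case: (\int[P]_t _)%E => [r| |] //=; rewrite -EFinD => -[h].
  rewrite lee_fin.
  have : 0 <= n%:R * e ^+ 2 by rewrite mulr_ge0 ?ler0n ?sqr_ge0.
  move: h; rewrite -/c; lra.
(* Markov's inequality: on [D] the squared deviation is at least [(c / 2) ^ 2]. *)
have key : (((c / 2) ^+ 2)%:E * P D <= c%:E)%E.
  have mI : measurable_fun setT (fun t => (\1_D t : R)%:E).
    by apply/measurable_EFinP; exact: measurable_indic.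
  have I_ge0 t : setT t -> (0 <= (\1_D t : R)%:E)%E by rewrite lee_fin indicE ler0n.
  have sq_ge0 : (0 <= ((c / 2) ^+ 2)%:E)%E by rewrite lee_fin sqr_ge0.
  have <- : (\int[P]_t (((c / 2) ^+ 2)%:E * (\1_D t)%:E) = ((c / 2) ^+ 2)%:E * P D)%E.
    by rewrite (ge0_integralZl P measurableT mI I_ge0 sq_ge0) integral_indic // setIT.
  apply: le_trans iV.
  apply: ge0_le_integral => //.
  - by move=> t _; rewrite -EFinM lee_fin mulr_ge0 ?sqr_ge0 // indicE ler0n.
  - by apply/measurable_EFinP; apply: measurable_funM => //; exact: measurable_indic.
  - by apply/measurable_EFinP; apply: measurable_funX; apply: measurable_funB.
  move=> t _; rewrite -EFinM lee_fin indicE.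
  case: (boolP (t \in D)) => [|_]; last by rewrite mulr0 sqr_ge0.
  rewrite inE /D /few_hits /= SE => Dt; rewrite mulr1.
  have : S t <= c / 2 by rewrite /c [n%:R * e]mulrC.
  move=> h; rewrite -[in leRHS]sqrrN ler_sqr ?nnegrE; lra.
rewrite -(@lee_pmul2l _ ((c / 2) ^+ 2)%:E) ?lte_fin ?exprn_gt0 ?divr_gt0 //.
apply: le_trans key _; rewrite -EFinM lee_fin /c le_eqVlt; apply/orP; left.
have e0 : e != 0 by rewrite gt_eqF.
have n0 : n%:R != 0 :> R by rewrite gt_eqF ?ltr0n.
by apply/eqP; field; rewrite e0 n0.
Qed.

(** * Tail bounds for a Poisson variable *)

Section Poisson.
Variables (f : T -> nat) (x : R).
Hypotheses (x_gt0 : 0 < x) (mf : forall k, measurable (f @^-1` [set k])).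
Hypothesis f_poisson : forall k, P [set t | f t = k] = (poisson_pmf x k)%:E.

(** Chernoff bound with base 2, the expectation of [2 ^ f] being [expR x]. *)
Lemma poisson_tail (k : nat) : (P [set t | (k <= f t)%N] <= (expR x / 2 ^+ k)%:E)%E.
Proof.
have -> : [set t | (k <= f t)%N] = \bigcup_(j in [set j | (k <= j)%N]) (f @^-1` [set j]).
  apply/seteqP; split => t /= h; first by exists (f t).
  by case: h => j kj /= ->.
rewrite measure_bigcup //; last first.
  by move=> a b _ _ [t [/= fa fb]]; rewrite -fa -fb.
apply: lime_le; first by apply: is_cvg_nneseries.
apply: nearW => n.
rewrite (eq_bigr (fun j => (poisson_pmf x j)%:E)); last by move=> j _; exact: f_poisson.
rewrite sumEFin lee_fin.
have pow_gt0 : 0 < 2 ^+ k :> R by rewrite exprn_gt0.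
rewrite ler_pdivlMr // mulr_suml.
(* The second factor dominates the partial sums of its series, and for [k <= j] the factor [2 ^ k]
   is at most the [2 ^ j] of the term of index [j]. *)
have -> : expR x = expR (- x) * expR (2 * x) by rewrite -expRD; congr expR; ring.
apply: (@le_trans _ _ (expR (- x) * \sum_(0 <= j < n) exp_coeff (2 * x) j)); last first.
  rewrite ler_pM2l ?expR_gt0 //.
  apply: (nondecreasing_cvgn_le _ (is_cvg_series_exp_coeff (2 * x)) n).
  apply/nondecreasing_seqP => j; rewrite /series /= big_nat_recr //= lerDl.
  by rewrite /exp_coeff /= divr_ge0 ?exprn_ge0 ?mulr_ge0 // ltW.
rewrite mulr_sumr big_mkcond /=; apply: ler_sum => j _.
have t_ge0 : 0 <= expR (- x) * exp_coeff (2 * x) j.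
  by rewrite mulr_ge0 ?expR_ge0 // /exp_coeff /= divr_ge0 ?exprn_ge0 ?mulr_ge0 // ltW.
case: ifPn => // /set_mem /= kj.
rewrite /poisson_pmf x_gt0 /exp_coeff /= exprMn.
have -> : expR (- x) * (2 ^+ j * x ^+ j / j`!%:R) =
    x ^+ j / j`!%:R * expR (- x) * 2 ^+ j by ring.
apply: ler_wpM2l; last by rewrite ler_eXn2l // ltr1n.
by rewrite mulr_ge0 ?expR_ge0 // divr_ge0 ?exprn_ge0 // ltW.
Qed.

Lemma poisson_ge1 : (P [set t | (1 <= f t)%N] <= x%:E)%E.
Proof.
have -> : [set t | (1 <= f t)%N] = ~` (f @^-1` [set 0%N]).
  by apply/seteqP; split => t /=; case: (f t).
rewrite probability_setC // f_poisson -EFinB lee_fin /poisson_pmf x_gt0.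
rewrite expr0 fact0 divr1 mul1r.
have := expR_ge1Dx (- x); lra.
Qed.

(** The probability is [1 - (1 + x) expR (- x)], at most [1 - (1 + x) (1 - x) = x ^ 2]. *)
Lemma poisson_ge2 : (P [set t | (2 <= f t)%N] <= (x ^+ 2)%:E)%E.
Proof.
have -> : [set t | (2 <= f t)%N] = ~` (f @^-1` [set 0%N] `|` f @^-1` [set 1%N]).
  apply/seteqP; split => t /=; first by case: (f t) => [//|[//|n]] _ [].
  by case: (f t) => [|[|n]] // h; exfalso; apply: h; [left|right].
rewrite probability_setC; last exact: measurableU.
have -> : P (f @^-1` [set 0%N] `|` f @^-1` [set 1%N]) =
    (poisson_pmf x 0 + poisson_pmf x 1)%:E.
  rewrite measureU //; last by apply/seteqP; split => t //= [-> ].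
  by rewrite EFinD; congr (_ + _)%E; exact: f_poisson.
rewrite -EFinB lee_fin /poisson_pmf x_gt0.
have -> : 1`! = 1%N by [].
rewrite expr0 expr1 fact0 !divr1 mul1r.
have h := expR_ge1Dx (- x).
have : (1 + x) * (1 - x) <= (1 + x) * expR (- x) 
  by apply: ler_wpM2l; [rewrite addr_ge0 // ltW|exact: h].
lra.
Qed.

End Poisson.
End ProbabilityTools.

(** * Union bound and negligible sets *)

Section NullSets.
Context (d : measure_display) (T : measurableType d) (R : realType).
Variable P : probability T R.

Lemma union_bound_fin (J : finType) (A : J -> set T) :
  (forall j, measurable (A j)) -> (P (\bigcup_j A j) <= \sum_j P (A j))%E.
Proof.
move=> mA.
have -> : \bigcup_j A j = \big[setU/set0]_(j <- enum J) A j.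
  rewrite -bigcup_seq; apply/seteqP; split => t [j _ At]; exists j => //=.
  by rewrite mem_enum.
rewrite -[leRHS]big_enum /=.
elim: (enum J) => [|j s IH]; first by rewrite !big_nil measure0.
rewrite !big_cons; apply: (le_trans (measureU2 _ _ _)) => //.
  by apply: bigsetU_measurable.
by rewrite leeD2l.
Qed.

(** The intersection of covers of probability at most [1 / (n + 1)] is a measurable null set that
    contains [Z]. *)
Lemma negligible_approx (Z : set T) :
  (forall e : R, 0 < e -> exists B, [/\ measurable B, Z `<=` B & (P B <= e%:E)%E]) ->
  P.-negligible Z.
Proof.
move=> small.
have /choice[B BP] : forall n : nat, exists B,
    [/\ measurable B, Z `<=` B & (P B <= (n.+1%:R^-1)%:E)%E].
  by move=> n; apply: small; rewrite invr_gt0 ltr0n.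
have mB : measurable (\bigcap_n B n).
  by apply: bigcap_measurable => [|n _]; [exists 0%N|have [] := BP n].
exists (\bigcap_n B n); split=> //; last by move=> t Zt n _; have [_ h _] := BP n; exact: h.
apply/eqP; rewrite eq_le measure_ge0 andbT.
apply/lee_addgt0Pr => e e_gt0; rewrite add0e.
have [n ne] : exists n : nat, n.+1%:R^-1 <= e.
  exists (Num.Def.truncn e^-1); rewrite -[e]invrK lef_pV2 ?posrE ?ltr0n ?invr_gt0 //.
  by rewrite invrK ltW // truncnS_gt.
have [mBn _ PBn] := BP n.
apply: le_trans (le_trans PBn _); last by rewrite lee_fin.
by apply: le_measure; rewrite ?inE // => t h; exact: h.
Qed.

Lemma ae_forall_countable (V : countType) (Q : V -> T -> Prop) :
  (forall y, {ae P, forall t, Q y t}) -> {ae P, forall t, forall y, Q y t}.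
Proof.
move=> ae; have : {ae P, forall t, forall n,
    odflt True (omap (fun y => Q y t) (unpickle n))}.
  by apply: ae_foralln => n; case: (unpickle n) => [y|] /=; [exact: ae|exact: aeW].
by apply: filterS => t h y; have := h (pickle y); rewrite pickleK.
Qed.

End NullSets.

(** * Probability of a schedule of rings, and almost sure properties of the noise *)

Section Noise.
Variables (R : realType) (K : nat) (dr v b : R).
Hypotheses (dr_gt0 : 0 < dr) (v_gt0 : 0 < v) (b_gt0 : 0 < b).
Context (disp : measure_display) (Om : measurableType disp).
Variables (P : probability Om R) (X : noise R K Om).
Hypothesis HX : dpd_noise P dr v b X.

Local Notation N := (ring_count X).
Local Notation rate := (@clock_rate R K dr v b).

Lemma clock_rate_gt0 c : 0 < rate c.
Proof. by case: c. Qed.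

Lemma ring_count_measurable c t n : 0 <= t -> measurable (N c t @^-1` [set n]).
Proof.
move=> t0; rewrite -[X in measurable X]setTI.
exact: (poisson_measurable (noise_clocks HX c) t0).
Qed.

Lemma ring_count_nondecreasing c w (s t : R) : 0 <= s -> s <= t -> (N c s w <= N c t w)%N.
Proof. exact: (poisson_nondecreasing (noise_clocks HX c)). Qed.

(** [measurable_nat_fun2] is applied to [Om] with the sigma-algebra generated by the single clock
    [c], as independence between clocks demands. *)
Lemma process_events_rings c (s t : R) (Q : nat -> nat -> Prop) : 0 <= s -> 0 <= t ->
  process_events (N c) [set w | Q (N c s w) (N c t w)].
Proof.
move=> s0 t0.
pose G := \bigcup_(t in [set t : R | 0 <= t]) events_of (N c t).
apply: (@measurable_nat_fun2 _ (g_sigma_algebraType G)) => n; apply: sub_sigma_algebra.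
  by exists s => //; exists [set n].
by exists t => //; exists [set n].
Qed.

Lemma process_events_bigcap (J : finType) c (A : J -> set Om) :
  (forall j, process_events (N c) (A j)) -> process_events (N c) (\bigcap_j A j).
Proof.
pose G := \bigcup_(t in [set t : R | 0 <= t]) events_of (N c t).
by move=> h; apply: (@measurable_bigcap_fin _ (g_sigma_algebraType G)).
Qed.

Lemma measurable_rings c (s t : R) (Q : nat -> nat -> Prop) : 0 <= s -> 0 <= t ->
  measurable [set w | Q (N c s w) (N c t w)].
Proof. by move=> s0 t0; apply: measurable_nat_fun2 => n; exact: ring_count_measurable. Qed.

(** One condition for each clock, on its increment: the form to which both kinds of independence
    apply. *)
Lemma one_ring_increments c (s t : R) w : 0 <= s -> s <= t ->
  one_ring X c s t w <-> forall c', (N c' t w - N c' s w)%N = (c' == c).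
Proof.
move=> s0 st; split => [[cr cf] c'|h].
  case: eqVneq => [->|/eqP/cf ->]; last by rewrite subnn.
  by rewrite cr subSn // subnn.
have le c' := ring_count_nondecreasing c' w s0 st.
split; first by rewrite -(subnK (le c)) h eqxx.
by move=> c' /eqP c'c; rewrite -(subnK (le c')) h (negbTE c'c).
Qed.

Section Schedule.
Variables (Q : finType) (U : Q -> nat) (ce : Q -> clock K * (bool * bool)).
Hypothesis U_inj : injective U.

Definition is_move (c : clock K) : bool := if c is MoveClock _ then true else false.

(** Only the rings are prescribed here; [scheduled] adds the directions of the moves. The slots are
    indexed by any finite type, so that one window and two windows are treated alike. *)
Definition timed : set Om :=
  [set w | forall k, one_ring X (ce k).1 (U k)%:R (U k).+1%:R w].

Definition scheduled : set Om :=
  [set w | forall k, one_ring X (ce k).1 (U k)%:R (U k).+1%:R w /\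
                     heeds X (ce k) (N (ce k).1 (U k)%:R w) w].

(** The probability of one slot: in a unit of time the clock [e.1] rings once and the others do not,
    and a move takes the prescribed direction out of four. *)
Definition slot_weight (e : clock K * (bool * bool)) : R :=
  (if is_move e.1 then 4^-1 else 1) * \prod_c poisson_pmf (rate c) (c == e.1).


Let slot_events c k (Qp : nat -> nat -> Prop) :
  process_events (N c) [set w | Qp (N c (U k)%:R w) (N c (U k).+1%:R w)].
Proof. by apply: process_events_rings; rewrite ler0n. Qed.

Let timed_clock (c : clock K) : set Om :=
  \bigcap_k [set w | (N c (U k).+1%:R w - N c (U k)%:R w)%N = (c == (ce k).1)].

Let timedE : timed = \bigcap_c timed_clock c.
Proof.
apply/seteqP; split => w /= h.
  by move=> c _ k _ /=; move/one_ring_increments: (h k); apply; rewrite ?ler0n ?ler_nat.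
move=> k; apply/one_ring_increments; rewrite ?ler0n ?ler_nat //.
by move=> c; exact: h.
Qed.

Lemma measurable_timed : measurable timed.
Proof.
rewrite timedE; apply: measurable_bigcap_fin => c; apply: measurable_bigcap_fin => k.
exact: (measurable_rings c (fun x y => (y - x)%N = (c == (ce k).1)) (ler0n _ _) (ler0n _ _)).
Qed.

Lemma measurable_heeds k n : measurable [set w | heeds X (ce k) n w].
Proof.
rewrite /heeds; case: (ce k).1 => [i|p|i]; try exact: measurableT.
exact: (noise_directions HX i n).1.
Qed.

Lemma measurable_scheduled : measurable scheduled.
Proof.
(* The direction consulted has a random index, the current ring number; its possible values are
   separated. *)
have -> : scheduled = timed `&` \bigcap_k
    \bigcup_n (N (ce k).1 (U k)%:R @^-1` [set n] `&` [set w | heeds X (ce k) n w]).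
  apply/seteqP; split => w /=.
    move=> h; split => [k|k _]; first by have [] := h k.
    by exists (N (ce k).1 (U k)%:R w) => //; split=> //; have [] := h k.
  by move=> [h1 h2] k; split; [exact: h1|have [n _ [/= -> ]] := h2 k I].
apply: measurableI; first exact: measurable_timed.
apply: measurable_bigcap_fin => k; apply: bigcup_measurable => n _.
by apply: measurableI; [apply: ring_count_measurable; rewrite ler0n|exact: measurable_heeds].
Qed.

(** Independence of the clocks, then of the increments of each clock over the distinct unit
    intervals selected by [U]. *)
Lemma probability_timed :
  P timed = (\prod_k \prod_c poisson_pmf (rate c) (c == (ce k).1))%:E.
Proof.
rewrite timedE.
rewrite (independent_classes_fin (noise_independent HX) (s := fun c => ClockSource c)).
- rewrite exchange_big -prodEFin; apply: eq_bigr => c _.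
  have nat_ge0 : 0 <= 0%:R :> R by [].
  have nat_nd k : k%:R <= k.+1%:R :> R by rewrite ler_nat.
  have ind := poisson_independent_increments (noise_clocks HX c) nat_ge0 nat_nd.
  rewrite (independent_classes_fin ind U_inj) => [|k]; last first.
    by exists [set (c == (ce k).1) : nat].
  rewrite -prodEFin; apply: eq_bigr => k _.
  rewrite (poisson_increments (noise_clocks HX c)) ?ler0n ?ltr_nat //.
  by rewrite -natr1 addrAC subrr add0r mulr1.
- by move=> c c' [].
- move=> c; apply: process_events_bigcap => k.
  exact: (@slot_events c k (fun x y => (y - x)%N = (c == (ce k).1))).
Qed.

Let counts (w : Om) : {ffun Q -> nat} := [ffun k => N (ce k).1 (U k)%:R w].

(** A clock scheduled in two slots advances during the earlier one, so that its two rings have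
    different numbers and consult different directions. *)
Let counts_inj w k l : timed w -> (ce k).1 = (ce l).1 -> counts w k = counts w l -> k = l.
Proof.
move=> tw; wlog kl : k l / (U k <= U l)%N => [hw kl|].
  by case: (leqP (U k) (U l)) => [|/ltnW] h ekl; [exact: hw|exact/esym/hw].
move=> ekl; rewrite /counts !ffunE -ekl => eN.
move: kl; rewrite leq_eqVlt => /orP[/eqP/U_inj//|kl].
have [cr _] := tw k.
have : (N (ce k).1 (U k).+1%:R w <= N (ce k).1 (U l)%:R w)%N.
  by apply: ring_count_nondecreasing; rewrite ?ler0n // ler_nat.
by rewrite cr eN ltnn.
Qed.

(* Given the ring numbers [a] of the scheduled rings, the directions used are
   those of fixed, pairwise distinct indices. *)
Let probability_scheduled_counts (a : {ffun Q -> nat}) :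
  (P (scheduled `&` counts @^-1` [set a]) =
   (\prod_k (if is_move (ce k).1 then 4^-1 else 1))%:E *
   P (timed `&` counts @^-1` [set a]))%E.
Proof.
(* If no outcome has the ring numbers [a], both sides vanish. Otherwise the outcome [w0] shows,
   through [counts_inj], that the direction indices are distinct. *)
have [[w0 [tw0 cw0]]|no] := pselect (exists w, (timed `&` counts @^-1` [set a]) w); last first.
  have e1 : timed `&` counts @^-1` [set a] = set0.
    by apply/seteqP; split => w // h; apply: no; exists w.
  have e2 : scheduled `&` counts @^-1` [set a] = set0.
    apply/seteqP; split => w // [h1 h2]; apply: no; exists w; split=> //.
    by move=> k; have [] := h1 k.
  by rewrite e1 e2 measure0 mule0.
pose clockE (c : clock K) := \bigcap_k [set w |
  (N c (U k).+1%:R w - N c (U k)%:R w)%N = (c == (ce k).1) /\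
  ((ce k).1 = c -> N c (U k)%:R w = a k)].
have clockE_events c : process_events (N c) (clockE c).
  apply: process_events_bigcap => k.
  exact: (@slot_events c k (fun x y => (y - x)%N = (c == (ce k).1) /\
    ((ce k).1 = c -> x = a k))).
have timedaE : timed `&` counts @^-1` [set a] = \bigcap_c clockE c.
  apply/seteqP; split => w /=.
    move=> [tw cw] c _ k _ /=; split.
      by move: tw; rewrite timedE => /(_ c I k I).
    by move=> <-; rewrite -cw ffunE.
  move=> h; split; first by rewrite timedE => c _ k _; have [] := h c I k I.
  by apply/ffunP => k; rewrite ffunE; have [_ ->] := h (ce k).1 I k I.
pose M := {k : Q | is_move (ce k).1}.
(* All clocks, and one direction for each slot with a move. The last branch is excluded by the
   definition of [M]. *)
pose src (y : clock K + M) : source K :=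
  match y with
  | inl c => ClockSource c
  | inr k => if (ce (val k)).1 is MoveClock i then DirectionSource i (a (val k))
             else ClockSource (ce (val k)).1
  end.
pose ev (y : clock K + M) : set Om :=
  match y with
  | inl c => clockE c
  | inr k => [set w | heeds X (ce (val k)) (a (val k)) w]
  end.
have schedE : scheduled `&` counts @^-1` [set a] = \bigcap_y ev y.
  apply/seteqP; split => w /=.
    move=> [sw cw] [c|k] _ /=.
      suff : (timed `&` counts @^-1` [set a]) w by rewrite timedaE; exact.
      by split=> // k; have [] := sw k.
    by rewrite -cw ffunE; have [] := sw (val k).
  move=> h; have [tw cw] : (timed `&` counts @^-1` [set a]) w.
    by rewrite timedaE => c _; exact: (h (inl c) I).
  split=> // k; split; first exact: tw.
  have -> : N (ce k).1 (U k)%:R w = a k by rewrite -cw ffunE.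
  case mk : (is_move (ce k).1); first exact: (h (inr (exist _ k mk)) I).
  by move: mk; rewrite /heeds; case: (ce k).1.
have src_inj : injective src.
  move=> [c|k] [c'|l] //=.
  - by case=> ->.
  - by have := valP l; case: (ce (val l)).1.
  - by have := valP k; case: (ce (val k)).1.
  move=> kl; suff e : val k = val l by congr inr; exact: val_inj.
  have kE : (ce (val k)).1 = (ce (val l)).1 /\ a (val k) = a (val l).
    have := valP k; have := valP l; move: kl.
    by case: (ce (val k)).1 => // i; case: (ce (val l)).1 => // j [-> ->].
  by apply: (counts_inj tw0 kE.1); rewrite cw0 kE.2.
rewrite schedE timedaE.
rewrite (independent_classes_fin (noise_independent HX) src_inj); last first.
  case=> [c|[k mk]] /=; first exact: clockE_events.
  rewrite /heeds; move: mk; case: (ce k).1 => //= i _.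
  by exists [set (ce k).2].
rewrite (independent_classes_fin (noise_independent HX) (s := fun c => ClockSource c)).
- rewrite big_sumType /= muleC; congr (_ * _)%E.
  rewrite (eq_bigr (fun=> (4^-1)%:E)) => [|[k mk] _ /=].
    rewrite prodEFin -big_mkcond /= !prodr_const; congr (_%:E).
    by rewrite card_sig.
  rewrite /heeds; move: mk; case: (ce k).1 => //= i _.
  have [_ /(_ (ce k).2)] := noise_directions HX i (a k).
  by rewrite finset.inE cardsT card_prod card_bool => ->.
- by move=> c c' [].
- exact: clockE_events.
Qed.

(** The factor due to the directions is the same for all ring numbers [a], so it comes out of the
    sum over [a]. *)
Lemma probability_scheduled : P scheduled = (\prod_k slot_weight (ce k))%:E.
Proof.
rewrite (countable_split (f := counts) _ measurable_scheduled measurable_timed _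
  probability_scheduled_counts).
- by rewrite probability_timed -EFinM -big_split.
- move=> a; have -> : counts @^-1` [set a] = \bigcap_k (N (ce k).1 (U k)%:R @^-1` [set a k]).
    apply/seteqP; split => w /=; first by move=> <- k _; rewrite /= ffunE.
    by move=> h; apply/ffunP => k; rewrite ffunE; exact: h.
  by apply: measurable_bigcap_fin => k; apply: ring_count_measurable; rewrite ler0n.
- by rewrite prodr_ge0 // => k _; case: ifP.
Qed.

End Schedule.

(** For nonempty [A], its [#|A|] elements have probability [1 / #|A|] each, which adds up to 1. *)
Lemma child_in_ae :
  {ae P, forall w, forall i n (A : {set 'I_K}), A != finset.set0 -> child X i n A w \in A}.
Proof.
pose good (y : 'I_K * {set 'I_K}) n := [set w | y.2 != finset.set0 -> child X y.1 n y.2 w \in y.2].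
suff h y n : {ae P, forall w, good y n w}.
  have := ae_forall_countable (fun y => ae_foralln (h y)).
  by apply: filterS => w hw i n A; exact: (hw (i, A) n).
case: (eqVneq y.2 finset.set0) => [e|ne].
  by apply: aeW => w; rewrite /good /= e eqxx.
have [mC PC] := noise_children HX y.1 n y.2.
pose B := [set w | child X y.1 n y.2 w \in y.2].
have BE : B = \bigcup_(u in [set` y.2]) (child X y.1 n y.2 @^-1` [set u]).
  apply/seteqP; split => w /= h; first by exists (child X y.1 n y.2 w).
  by case: h => u /= uA e; rewrite /B /= e.
have mB : measurable B.
  by rewrite BE; apply: fin_bigcup_measurable => // u _; exact: mC.
have PB : P B = 1%E.
  transitivity (\int[P]_w (\1_B w : R)%:E)%E; first by rewrite integral_indic // setIT.
  transitivity (\int[P]_w (\sum_(u <- enum y.2) (\1_(child X y.1 n y.2 @^-1` [set u]) w : R))%:E)%E.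
    apply: eq_integral => w _; congr (_%:E).
    rewrite big_enum /= indicE.
    have [wB|wB] := pselect (B w).
      rewrite mem_set // (bigD1 (child X y.1 n y.2 w)) //= indicE mem_set //.
      rewrite big1 ?addr0 // => u /andP[_ uw]; rewrite indicE memNset //= => e.
      by move: uw; rewrite -e eqxx.
    rewrite memNset // big1 // => u uA; rewrite indicE memNset //= => e; apply: wB.
    by rewrite /B /= e.
  rewrite integral_sum_indic; last exact: mC.
  rewrite big_enum /= (eq_bigr (fun=> ((#|y.2|%:R)^-1)%:E)) => [|u uA]; last exact: PC.
  rewrite sumEFin sumr_const -[_ *+ _]mulr_natl divff // pnatr_eq0 -lt0n card_gt0 //.
exists (~` B); split; first exact: measurableC.
  by rewrite probability_setC // PB subee.
by move=> w /= h wB; apply: h => _.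
Qed.

(* Two rings in one cell of the mesh [1 / 2 ^ l] have probability of order
   [4 ^- l], and there are of order [2 ^ l] cells. *)
Lemma fine_mesh_ae :
  {ae P, forall w, forall T : nat, exists l : nat, forall u, (u < T * 2 ^ l)%N ->
    lone_ring X (u%:R / (2 ^ l)%:R) (u.+1%:R / (2 ^ l)%:R) w}.
Proof.
apply: ae_foralln => T; apply: negligible_approx => e e_gt0.
pose total := \sum_c rate c.
have rate_ge0 c : 0 <= rate c by rewrite ltW // clock_rate_gt0.
have total_ge0 : 0 <= total by rewrite sumr_ge0.
(* The left side is the sum of [total ^ 2 / 4 ^ l] over the [T * 2 ^ l] cells. *)
have [l lP] : exists l : nat, T%:R * total ^+ 2 / (2 ^ l)%:R <= e.
  exists (Num.Def.truncn (T%:R * total ^+ 2 / e)).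
  set z := (T%:R * total ^+ 2 / e).
  rewrite ler_pdivrMr ?ltr0n ?expn_gt0 // [e * _]mulrC -ler_pdivrMr // -/z.
  apply: (le_trans (ltW (truncnS_gt z))).
  by rewrite ler_nat ltn_expl.
pose h : R := ((2 ^ l)%:R)^-1.
have h_gt0 : 0 < h by rewrite invr_gt0 ltr0n expn_gt0.
pose s (u : nat) : R := u%:R / (2 ^ l)%:R.
have s_ge0 u : 0 <= s u by rewrite divr_ge0 ?ler0n.
have sS u : s u.+1 - s u = h by rewrite /s -mulrBl -natr1 addrAC subrr add0r mul1r.
have s_lt u : s u < s u.+1 by rewrite -subr_gt0 sS.
pose inc c u w := (N c (s u.+1) w - N c (s u) w)%N.
(* In a given cell, either one clock rings twice or two different clocks ring. *)
pose bad (y : 'I_(T * 2 ^ l) * (clock K * clock K)) : set Om :=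
  if y.2.1 == y.2.2 then [set w | (2 <= inc y.2.1 y.1 w)%N]
  else [set w | (1 <= inc y.2.1 y.1 w)%N] `&` [set w | (1 <= inc y.2.2 y.1 w)%N].
have m_inc c u k : measurable [set w | (k <= inc c u w)%N].
  exact: (measurable_rings c (fun x y => (k <= y - x)%N) (s_ge0 u) (s_ge0 u.+1)).
have m_bad y : measurable (bad y).
  by rewrite /bad; case: ifP => _ //; exact: measurableI.
have m_eq c u k : measurable (inc c u @^-1` [set k]).
  exact: (measurable_rings c (fun x y => (y - x)%N = k) (s_ge0 u) (s_ge0 u.+1)).
have inc_poisson c u k : P [set w | inc c u w = k] = (poisson_pmf (rate c * h) k)%:E.
  by rewrite (poisson_increments (noise_clocks HX c)) // sS.
have P_bad y : (P (bad y) <= (rate y.2.1 * rate y.2.2 * h ^+ 2)%:E)%E.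
  have rh c : 0 < rate c * h by rewrite mulr_gt0 // clock_rate_gt0.
  rewrite /bad; case: eqP => [<-|ne].
    apply: (le_trans (poisson_ge2 (rh _) (m_eq _ _) (inc_poisson _ _))).
    by rewrite lee_fin exprMn -expr2.
  have ev c : process_events (N c) [set w | (1 <= inc c y.1 w)%N].
    exact: (@process_events_rings c _ _ (fun x y => is_true (1 <= y - x)%N)
      (s_ge0 y.1) (s_ge0 y.1.+1)).
  pose A (k : bool) := [set w | (1 <= inc (if k then y.2.1 else y.2.2) y.1 w)%N].
  have -> : [set w | (1 <= inc y.2.1 y.1 w)%N] `&` [set w | (1 <= inc y.2.2 y.1 w)%N] =
      \bigcap_k A k.
    apply/seteqP; split => w /=; first by move=> [h1 h2] [] _.
    by move=> hA; split; [exact: (hA true)|exact: (hA false)].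
  rewrite (independent_classes_fin (noise_independent HX)
    (s := fun k : bool => ClockSource (if k then y.2.1 else y.2.2))).
  - rewrite big_bool /= /A /=.
    have ->: rate y.2.1 * rate y.2.2 * h ^+ 2 = (rate y.2.1 * h) * (rate y.2.2 * h) by ring.
    rewrite EFinM; apply: lee_pmul => //.
      exact: (poisson_ge1 (rh _) (m_eq _ _) (inc_poisson _ _)).
    exact: (poisson_ge1 (rh _) (m_eq _ _) (inc_poisson _ _)).
  - by move=> [] [] //= [e1]; case: ne; rewrite e1.
  - by move=> k; exact: ev.
exists (\bigcup_y bad y); split.
- exact: measurable_bigcup_fin.
- move=> w /= /forallNP /(_ l) /existsNP[u /not_implyP[uT not_lone]].
  apply: contrapT => no_bad; apply: not_lone.
  have nb c c' : ~ bad (Ordinal uT, (c, c')) w.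
    by move=> hb; apply: no_bad; exists (Ordinal uT, (c, c')).
  have inc_le1 c : (inc c u w <= 1)%N.
    by have := nb c c; rewrite /bad /= eqxx => /negP; rewrite -ltnNge ltnS.
  have incE c : N c (s u.+1) w = (N c (s u) w + inc c u w)%N.
    by rewrite /inc subnKC // ring_count_nondecreasing // ltW.
  case: (pselect (exists c, inc c u w = 1%N)) => [[c c1]|no].
    right; exists c; split; first by rewrite incE c1 addn1.
    move=> c' c'c; rewrite incE; have := inc_le1 c'.
    rewrite leq_eqVlt ltnS leqn0 => /orP[/eqP c'1|/eqP ->]; last by rewrite addn0.
    have h1 : (1 <= inc c u w)%N by rewrite c1.
    have h2 : (1 <= inc c' u w)%N by rewrite c'1.
    exfalso; apply: (nb c c'); rewrite /bad /= ifF; first by split.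
    by apply/eqP => e1; apply: c'c.
  left=> c; rewrite incE; have := inc_le1 c.
  rewrite leq_eqVlt ltnS leqn0 => /orP[/eqP c'1|/eqP ->]; last by rewrite addn0.
  by exfalso; apply: no; exists c.
apply: (le_trans (union_bound_fin P m_bad)).
apply: (@le_trans _ _ (\sum_(y : 'I_(T * 2 ^ l) * (clock K * clock K))
    (rate y.2.1 * rate y.2.2 * h ^+ 2)%:E)%E); first by apply: lee_sum => y _.
rewrite sumEFin lee_fin -(pair_bigA _ (fun (u : 'I_(T * 2 ^ l)) (y : clock K * clock K) =>
  rate y.1 * rate y.2 * h ^+ 2)) /= sumr_const card_ord.
rewrite -(pair_bigA _ (fun c c' => rate c * rate c' * h ^+ 2)) /=.
have -> : \sum_c \sum_c' rate c * rate c' * h ^+ 2 = total ^+ 2 * h ^+ 2.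
  rewrite [total ^+ 2]expr2 /total mulr_suml mulr_suml; apply: eq_bigr => c _.
  by rewrite mulr_sumr mulr_suml.
apply: le_trans lP; rewrite -[_ *+ (T * 2 ^ l)]mulr_natl natrM le_eqVlt; apply/orP; left.
by apply/eqP; rewrite /h; field; rewrite pnatr_eq0 expn_eq0.
Qed.

End Noise.

(** * Drift of the wealth of a surviving cooperator *)

Section Drift.
Variables (R : realType) (m K : nat) (dr v b : R).
Hypotheses (m_gt0 : (0 < m)%N) (dr_gt0 : 0 < dr) (v_gt0 : 0 < v) (b_gt0 : 0 < b).

Local Notation weight := (@slot_weight R K dr v b).

Definition script_chance (i : 'I_K) : R := \prod_(ce <- script m i) weight ce.

Lemma slot_weight_gt0 ce : 0 < weight ce.
Proof.
rewrite /slot_weight mulr_gt0 //; first by case: ifP => _ //; rewrite invr_gt0.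
rewrite prodr_gt0 // => c _; have c_gt0 : 0 < clock_rate dr v b c by case: c.
rewrite /poisson_pmf c_gt0 mulr_gt0 ?expR_gt0 // divr_gt0 ?exprn_gt0 // ltr0n fact_gt0.
Qed.

Lemma script_chance_gt0 i : 0 < script_chance i.
Proof. by rewrite prodr_gt0 // => ce _; exact: slot_weight_gt0. Qed.

Lemma size_script_gt0 (i : 'I_K) : (0 < size (script m i))%N.
Proof. by case: m m_gt0. Qed.

(* Chosen so that the Chernoff bound [expR v / 2 ^+ ring_bound] is at most [1 / 2]. *)
Definition ring_bound : nat := (Num.Def.truncn (2 * expR v)).+1.

(** Per window, the slope of the games is the cardinality times [ring_bound] times the size of the
    script, and that of the hits is half of [script_chance]. Twice their ratio is taken; the summand
    1 gives a margin linear in time that absorbs the initial terms. *)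
Definition drift_threshold (i : 'I_K) : R :=
  1 + 4 * (#|{: upair K}| * ring_bound * size (script m i))%:R / script_chance i.

Context (disp : measure_display) (Om : measurableType disp).
Variables (P : probability Om R) (X : noise R K Om).
Hypothesis HX : dpd_noise P dr v b X.

(** Over a time [T], the bound of [poisson_tail] is the [T]-th power of
    [expR v / 2 ^+ ring_bound]. *)
Lemma game_rings_tail (p : upair K) (T : nat) : (0 < T)%N ->
  (P [set w | (ring_bound * T <= ring_count X (GameClock p) T%:R w)%N] <=
    (2^-1 ^+ T)%:E)%E.
Proof.
move=> T_gt0; have vT : 0 < v * T%:R by rewrite mulr_gt0 ?ltr0n.
have mf k : measurable (ring_count X (GameClock p) T%:R @^-1` [set k]).
  by apply: (ring_count_measurable HX); rewrite ler0n.
have poi k : P [set w | ring_count X (GameClock p) T%:R w = k] = (poisson_pmf (v * T%:R) k)%:E.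
  rewrite -(subr0 T%:R) -(poisson_increments (noise_clocks HX (GameClock p))) ?ltr0n //.
  congr (P _); apply/seteqP; split => w /=;
    by rewrite (poisson_start (noise_clocks HX (GameClock p))) subn0 subr0.
apply: (le_trans (poisson_tail vT mf poi _)); rewrite lee_fin.
rewrite expRM_natr exprM -expr_div_n.
apply: lerXn2r; rewrite ?nnegrE ?invr_ge0 // ?divr_ge0 ?expR_ge0 ?exprn_ge0 //.
rewrite ler_pdivrMr ?exprn_gt0 // mulrC ler_pdivlMr // mulrC.
apply: (le_trans (ltW (truncnS_gt _))).
by rewrite -natrX ler_nat ltnW // ltn_expl.
Qed.

Section Hits.
Variables (i : 'I_K) (n0 : nat).
Local Notation L := (size (script m i)).
Local Notation eps := (script_chance i).

Let ce (u : 'I_L) := tnth (in_tuple (script m i)) u.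

Lemma obeysE n w : obeys X n (script m i) w <-> scheduled X (fun u : 'I_L => n + u)%N ce w.
Proof.
have nthE ce0 (u : 'I_L) : nth ce0 (script m i) u = ce u by rewrite /ce (tnth_nth ce0).
split => [h u|h u ce0 uL]; first by have := h u (ce u) (ltn_ord u); rewrite nthE.
by have := h (Ordinal uL); rewrite -(nthE ce0).
Qed.

Lemma weights_script : \prod_u weight (ce u) = eps.
Proof. by rewrite /eps /script_chance (big_tnth _ _ (script m i)). Qed.

Definition hit (n : nat) : set Om := [set w | obeys X (n0 + n * L) (script m i) w].

Lemma hitE n : hit n = scheduled X (fun u : 'I_L => n0 + n * L + u)%N ce.
Proof. by apply/seteqP; split => w /obeysE. Qed.

Lemma measurable_hit n : measurable (hit n).
Proof. by rewrite hitE; exact: (measurable_scheduled HX). Qed.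

Lemma probability_hit n : P (hit n) = eps%:E.
Proof.
rewrite hitE (probability_scheduled HX) ?weights_script //.
by move=> u u' /addnI /val_inj.
Qed.

(** The two windows form one schedule indexed by a sum type. Its slots are distinct because, after
    subtraction of [n0], division by [L] recovers the window. *)
Lemma probability_hit2 n k : n != k -> P (hit n `&` hit k) = (eps ^+ 2)%:E.
Proof.
move=> nk.
pose U (y : 'I_L + 'I_L) : nat :=
  match y with inl u => n0 + n * L + u | inr u => n0 + k * L + u end.
pose ce2 (y : 'I_L + 'I_L) := match y with inl u => ce u | inr u => ce u end.
have -> : hit n `&` hit k = scheduled X U ce2.
  rewrite !hitE; apply/seteqP; split => w /=.
    by move=> [h1 h2] [u|u]; [exact: h1|exact: h2].
  by move=> h; split=> u; [exact: (h (inl u))|exact: (h (inr u))].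
rewrite (probability_scheduled HX).
  by rewrite big_sumType /= !weights_script.
have diff (u u' : 'I_L) : (n0 + n * L + u)%N <> (n0 + k * L + u')%N.
  rewrite -!addnA => /addnI /(congr1 (fun y => y %/ L)%N).
  rewrite !divnMDl ?size_script_gt0 // !divn_small ?ltn_ord // !addn0 => e.
  by rewrite e eqxx in nk.
move=> [u|u] [u'|u'] /=.
- by move/addnI/val_inj ->.
- by move/diff.
- by move/esym/diff.
- by move/addnI/val_inj ->.
Qed.

(* Over a long time the number of hits is at least [eps / 2] per window and the
   number of rings of each game clock at most [ring_bound] per unit time. *)
Lemma hits_dominate (rew suc M : R) : 0 < rew -> drift_threshold i * rew < suc ->
  P.-negligible [set w | forall k,
    suc *+ (\sum_(n < k) `[< hit n w >])%N
      < M + rew *+ game_rings X (n0 + k * L)%:R w].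
Proof.
move=> rew_gt0 thr; apply: negligible_approx => e e_gt0.
have eps_gt0 := script_chance_gt0 i.
set np := #|{: upair K}|.
pose D : R := (np * ring_bound)%:R.
have D_ge0 : 0 <= D by rewrite ler0n.
(* The first term makes the exceptional probability at most [e], the second absorbs [M] and the
   games up to time [n0], and the last ensures [0 < k]. *)
pose z := (4 / eps + np%:R) / e + `|M + rew * D * n0%:R| / (rew * eps / 2) + 1.
have [k kz] : exists k : nat, z <= k%:R.
  by exists (Num.Def.truncn z).+1; rewrite ltW // truncnS_gt.
have z1_ge0 : 0 <= (4 / eps + np%:R) / e.
  by rewrite divr_ge0 ?addr_ge0 ?ler0n ?divr_ge0 // ltW.
have re_gt0 : 0 < rew * eps / 2 by rewrite divr_gt0 ?mulr_gt0.
have z2_ge0 : 0 <= `|M + rew * D * n0%:R| / (rew * eps / 2).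
  by rewrite divr_ge0 // ltW.
have k_gt0 : 0 < k%:R :> R by move: kz; rewrite /z; lra.
have k_gt0' : (0 < k)%N by rewrite ltr0n in k_gt0.
set T := (n0 + k * L)%N.
have kT : (k <= T)%N by rewrite (leq_trans _ (leq_addl _ _)) // leq_pmulr // size_script_gt0.
have T_gt0 : (0 < T)%N by exact: leq_trans kT.
have [mF PF] := pairwise_chebyshev measurable_hit probability_hit probability_hit2 eps_gt0 k_gt0'.
pose busy (p : upair K) := [set w | (ring_bound * T <= ring_count X (GameClock p) T%:R w)%N].
have m_busy p : measurable (busy p).
  exact: (measurable_rings HX (GameClock p) (fun x y => (ring_bound * T <= x)%N)
    (ler0n R T) (ler0n R T)).
have mb : measurable (\bigcup_p busy p) by exact: measurable_bigcup_fin.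
exists (few_hits hit eps k `|` \bigcup_p busy p); split.
- exact: measurableU.
(* Outside the cover, the inequality already fails for this single [k]. *)
- move=> w /= /(_ k); rewrite -/T => hk.
  apply: contrapT => /not_orP[nF nb].
  move/negP: nF; rewrite -ltNge => nF.
  have G_le : (game_rings X T%:R w <= np * (ring_bound * T))%N.
    rewrite /game_rings /np -sum1_card big_distrl /=; apply: leq_sum => p _.
    rewrite mul1n leqNgt; apply/negP => h; apply: nb; exists p => //.
    exact: ltnW.
  have G_leR : (game_rings X T%:R w)%:R <= D * (n0%:R + k%:R * L%:R).
    by rewrite /D -natrM -natrD -natrM ler_nat -mulnA; exact: G_le.
  move: hk; apply/negP; rewrite -leNgt -[rew *+ _]mulr_natr -[suc *+ _]mulr_natr.
  set H : R := (\sum_(n < k) _)%N%:R in nF *.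
  have rG : rew * (game_rings X T%:R w)%:R <= rew * (D * (n0%:R + k%:R * L%:R)).
    by rewrite ler_pM2l.
  have thr' : rew * (4 * D * L%:R / eps + 1) <= suc.
    by move: (ltW thr); rewrite /drift_threshold -/np /D -!natrM; lra.
  have suc_H : rew * (4 * D * L%:R / eps + 1) * (eps * k%:R / 2) <= suc * H.
    apply: ler_pM => //; last exact: ltW.
      by rewrite mulr_ge0 ?addr_ge0 ?mulr_ge0 ?invr_ge0 // ltW.
    by rewrite divr_ge0 ?mulr_ge0 ?ler0n // ltW.
  have expand : rew * (4 * D * L%:R / eps + 1) * (eps * k%:R / 2) =
      2 * rew * D * L%:R * k%:R + rew * eps / 2 * k%:R.
    by field; rewrite gt_eqF.
  have Mk : M + rew * D * n0%:R <= rew * eps / 2 * k%:R.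
    apply: (le_trans (ler_norm _)); rewrite [_ * k%:R]mulrC -ler_pdivrMr //.
    by move: kz; rewrite /z; lra.
  have : 0 <= rew * D * L%:R * k%:R by rewrite !mulr_ge0 ?ler0n // ltW.
  move: suc_H; rewrite expand; lra.
apply: (le_trans (measureU2 _ mF mb)).
apply: (@le_trans _ _ ((4 / (eps * k%:R))%:E + (np%:R * 2^-1 ^+ T)%:E)%E).
  apply: leeD => //; apply: (le_trans (union_bound_fin P m_busy)).
  apply: (@le_trans _ _ (\sum_(p : upair K) (2^-1 ^+ T)%:E)%E).
    by apply: lee_sum => p _; exact: game_rings_tail.
  by rewrite sumEFin lee_fin sumr_const mulr_natl.
rewrite -EFinD lee_fin.
(* Since [k <= T], the geometric tail is brought to the same form [1 / k] as the Chebyshev bound. *)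
have pow : 2^-1 ^+ T <= k%:R^-1 :> R.
  rewrite exprVn lef_pV2 ?posrE ?exprn_gt0 // -natrX ler_nat.
  by rewrite (leq_trans kT) // ltnW // ltn_expl.
apply: (@le_trans _ _ ((4 / eps + np%:R) / k%:R)).
  rewrite [leRHS]mulrDl; apply: lerD; last by rewrite ler_wpM2l.
  by rewrite invfM mulrA.
rewrite ler_pdivrMr // [e * _]mulrC -ler_pdivrMr //.
by move: kz; rewrite /z; lra.
Qed.

End Hits.
End Drift.

(** * Choice of the constant and conclusion *)

Unset Implicit Arguments.

Theorem theorem2p2 (R : realType) (m K : nat) (d v b w0 wc : R)
    (hm : (1 <= m)%N) (hK : (1 <= K)%N)
    (hd : 0 < d) (hv : 0 < v) (hb : 0 < b) (hw0 : 0 < w0) (hwc : w0 < wc) :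
  exists mu : R, 0 < mu /\
    forall pT pR pS pP : R,
      pR < pT -> 0 < pR -> pP < pS -> 0 < pP -> mu * pR < pS ->
    forall s0 : config R m K,
      (exists i, strat (s0 i) = Defector /\ 0 < wealth (s0 i)) ->
    forall (disp : measure_display) (Om : measurableType disp)
      (P : probability Om R) (x : R -> Om -> config R m K),
      dpd_process P d v b w0 wc
        {| temptation := pT; reward := pR; sucker := pS; punishment := pP |}
        s0 x ->
      {ae P, forall w : Om, exists t0 : R, 0 <= t0 /\
        forall t : R, t0 <= t -> forall i, strat (x t w i) = Cooperator ->
          wealth (x t w i) <= 0}.
Proof.
pose thr := @drift_threshold R m K d v b.
have thr_gt0 i : 0 < thr i.
  rewrite ltr_pwDl // divr_ge0 ?mulr_ge0 ?ler0n // ltW //.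
  exact: script_chance_gt0.
have mu_ge i : thr i <= 1 + \sum_j thr j.
  rewrite (bigD1 i) //= addrCA lerDl addr_ge0 // sumr_ge0 // => j _; exact: ltW.
(* One constant above the thresholds of all the particles, none of which depends on the payoffs. *)
exists (1 + \sum_j thr j); split.
  by rewrite ltr_pwDl // sumr_ge0 // => j _; exact: ltW.
move=> pT pR pS pP RT R_gt0 PS P_gt0 muRS s0 def0 disp Om P x [X HX traj].
set g := Payoffs pT pR pS pP in traj.
(* The random starting time and wealth of a survivor are replaced by integers [n0] and [M], so that
   countably many null sets suffice. *)
have never i n0 M : {ae P, forall w, ~ forall k,
    pS *+ (\sum_(n < k) `[< hit m X i n0 n w >])%N
      < M%:R + pR *+ game_rings X (n0 + k * size (script m i))%:R w}.
  have thr_i : thr i * pR < pS by rewrite (le_lt_trans _ muRS) // ler_pM2r.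
  apply: negligibleS (hits_dominate hm hd hv hb HX n0 M%:R R_gt0 thr_i).
  by move=> w /= /contrapT.
have {}never : {ae P, forall w, forall n0 M i, ~ forall k,
    pS *+ (\sum_(n < k) `[< hit m X i n0 n w >])%N
      < M%:R + pR *+ game_rings X (n0 + k * size (script m i))%:R w}.
  apply: ae_foralln => n0; apply: ae_foralln => M.
  by apply: ae_forall_countable => i; exact: never.
have child_ok := child_in_ae HX.
have mesh_ok := fine_mesh_ae hd hv hb HX.
near=> w.
have tw : dpd_trajectory w0 wc g s0 X w (fun t => x t w) by near: w.
have cw : forall i n (A : {set 'I_K}), A != finset.set0 -> child X i n A w \in A by near: w.
have mw : forall T : nat, exists l : nat, forall u, (u < T * 2 ^ l)%N ->
    lone_ring X (u%:R / (2 ^ l)%:R) (u.+1%:R / (2 ^ l)%:R) w by near: w.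
have nw : forall n0 M i, ~ forall k,
    pS *+ (\sum_(n < k) `[< hit m X i n0 n w >])%N
      < M%:R + pR *+ game_rings X (n0 + k * size (script m i))%:R w by near: w.
have rings c (s t : R) : 0 <= s -> s <= t ->
  (ring_count X c s w <= ring_count X c t w)%N by exact: (ring_count_nondecreasing HX).
have reward_gt0 : 0 < reward g by [].
have temptation_gt0 : 0 < temptation g by exact: lt_trans RT.
have sucker_gt0 : 0 < sucker g by exact: lt_trans PS.
have dead i : exists2 t0 : R, 0 <= t0 & forall t, t0 <= t ->
    strat (x t w i) = Cooperator -> wealth (x t w i) <= 0.
  have [//|[n0 alive]] := cooperator_fate hw0 reward_gt0 sucker_gt0 tw cw rings mw i.
  (* An integer above the wealth at time [n0], as [nw] requires. *)
  pose M := (Num.Def.truncn (wealth (x n0%:R w i))).+1.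
  exfalso; apply: (nw n0 M i) => k.
  apply: (lt_trans (obeyed_drops hw0 hwc reward_gt0 temptation_gt0 sucker_gt0
    tw cw rings mw alive def0 k)).
  by rewrite ltrD2r truncnS_gt.
have /choice[t0 t0P] : forall i, exists t0 : R, 0 <= t0 /\ forall t, t0 <= t ->
    strat (x t w i) = Cooperator -> wealth (x t w i) <= 0.
  by move=> i; have [t0 h1 h2] := dead i; exists t0.
(* The times being nonnegative, their sum is beyond each of them. *)
exists (\sum_i t0 i); split; first by rewrite sumr_ge0 // => i _; have [] := t0P i.
move=> t tt i; have [_] := t0P i; apply.
apply: le_trans tt; rewrite (bigD1 i) //= lerDl sumr_ge0 // => j _.
by have [] := t0P j.
Unshelve. all: by end_near.
Qed.
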